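(* Let $1\le p<\infty$, $p\neq 2$. If $\phi\in\mathbb{A}$ is elliptic and $\psi\in\mathbb{A}$, then the isometry $M_\psi U_\phi$ on $H^p$ is Crownover.
   Context: $D$ is the open unit disc in $\mathbb{C}$, $H^p$ the Hardy space of $D$ with its usual norm. $\mathbb{A}$ is the group (under composition) of holomorphic automorphisms of $D$, i.e. the maps $\phi(z)=\frac{\lambda(z-a)}{1-\overline{a}z}$ with $a\in D$, $|\lambda|=1$; $e(z)=z$. $\phi\in\mathbb{A}$ is elliptic if $\phi\neq e$ and $\phi$ has a fixed point in $D$. For $F\in H^\infty$, $M_F$ is multiplication by $F$ on $H^p$; $C_\phi f=f\circ\phi$. For $\phi(z)=\frac{\lambda(z-a)}{1-\overline{a}z}$ in $\mathbb{A}$ put $U_\phi=M_{(\overline{\lambda}\phi')^{1/p}}C_\phi$, where $\overline\lambda\phi'(z)=\frac{1-|a|^2}{(1-\overline a z)^2}$ and the $p$-th root is the principal branch $(re^{i\theta})^{1/p}=r^{1/p}e^{i\theta/p}$, $r>0$, $-\pi<\theta<\pi$. For $\phi,\psi\in\mathbb{A}$ the operator $M_\psi U_\phi$ is an isometry of $H^p$ whose range has codimension one. A codimension one isometry $S$ on $H^p$ is Crownover if $\bigcap_{n=1}^\infty S^nH^p=(0)$. *)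

(* Defs.v *)
From Stdlib Require Import Reals Lra.
From Coquelicot Require Import Coquelicot.
Open Scope R_scope.

(** Functions on the open unit disc are represented by total functions
    [C -> C] of which only the values on the disc matter. *)

Definition in_disc (z : C) : Prop := Cmod z < 1.

Definition eq_on_disc (f g : C -> C) : Prop :=
  forall z, in_disc z -> f z = g z.

Definition holomorphic_on_disc (f : C -> C) : Prop :=
  forall z, in_disc z -> ex_derive (K := C_AbsRing) (V := C_NormedModule) f z.

(** Stdlib's [Rpower 0 p] is [1]; here [0 ^ p = 0]. *)
Definition rpow (x p : R) : R := if Rle_dec x 0 then 0 else Rpower x p.

Definition cis (t : R) : C := (cos t, sin t).

(** ** Hardy spaces *)

Definition integral_mean (p : R) (f : C -> C) (r : R) : R :=
  rpow (/ (2 * PI) *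
        RInt (fun t => rpow (Cmod (f (r * cis t)%C)) p) 0 (2 * PI)) (/ p).

Definition hardy_norm (p : R) (f : C -> C) : Rbar :=
  Lub_Rbar (fun m => exists r, 0 <= r < 1 /\ m = integral_mean p f r).

Definition in_Hp (p : R) (f : C -> C) : Prop :=
  holomorphic_on_disc f /\ is_finite (hardy_norm p f).

(** ** Automorphisms of the disc *)

Record disc_aut := DiscAut {
  aut_lambda : C;
  aut_a : C;
  aut_lambdaP : Cmod aut_lambda = 1;
  aut_aP : in_disc aut_a }.

Definition aut_fun (phi : disc_aut) (z : C) : C :=
  (aut_lambda phi * (z - aut_a phi) / (1 - Cconj (aut_a phi) * z))%C.

Coercion aut_fun : disc_aut >-> Funclass.

Definition elliptic (phi : disc_aut) : Prop :=
  ~ eq_on_disc phi (fun z => z) /\ exists z, in_disc z /\ phi z = z.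

(** [conj lambda * phi'(z)] in closed form. *)
Definition aut_weight (phi : disc_aut) (z : C) : C :=
  (RtoC (1 - Cmod (aut_a phi) ^ 2) / (1 - Cconj (aut_a phi) * z) ^ 2)%C.

(** Argument in (-PI, PI) of a point of the plane slit along the nonpositive
    reals, by the half-angle formula tan (t/2) = sin t / (1 + cos t); the
    value on the slit is irrelevant. *)
Definition principal_arg (z : C) : R := 2 * atan (Im z / (Cmod z + Re z)).

Definition principal_root (p : R) (z : C) : C :=
  (RtoC (rpow (Cmod z) (/ p)) * cis (principal_arg z / p))%C.

Lemma principal_root_polar (p r t : R) :
  0 < r -> - PI < t < PI ->
  principal_root p (r * cis t)%C = (RtoC (rpow r (/ p)) * cis (t / p))%C.
Proof.
intros Hr Ht.
assert (Hm : Cmod (r * cis t)%C = r).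
{ rewrite Cmod_mult, Cmod_R, (Rabs_pos_eq r) by lra.
  unfold Cmod, cis; simpl fst; simpl snd.
  replace (cos t ^ 2 + sin t ^ 2) with 1
    by (generalize (sin2_cos2 t); unfold Rsqr; intros; lra).
  rewrite sqrt_1; ring. }
assert (Ha : principal_arg (r * cis t)%C = t).
{ unfold principal_arg; rewrite Hm, re_scal_l, im_scal_l.
  unfold cis, Re, Im; simpl fst; simpl snd.
  assert (Hc : 0 < cos (t / 2)) by (apply cos_gt_0; lra).
  assert (E1 : sin t = 2 * sin (t / 2) * cos (t / 2))
    by (rewrite <- sin_2a; f_equal; field).
  assert (E2 : 1 + cos t = 2 * (cos (t / 2) * cos (t / 2))).
  { replace (cos t) with (cos (2 * (t / 2))) by (f_equal; field).
    rewrite cos_2a_cos; ring. }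
  replace (r * sin t / (r + r * cos t)) with (tan (t / 2)).
  - rewrite atan_tan; [field | lra].
  - replace (r + r * cos t) with (r * (1 + cos t)) by ring.
    rewrite E1, E2; unfold tan; field; split; lra. }
unfold principal_root; now rewrite Ha, Hm.
Qed.

(** ** Operators *)

Definition mul_op (F f : C -> C) : C -> C := fun z => (F z * f z)%C.

Definition comp_op (phi f : C -> C) : C -> C := fun z => f (phi z).

Definition U_op (p : R) (phi : disc_aut) (f : C -> C) : C -> C :=
  mul_op (fun z => principal_root p (aut_weight phi z)) (comp_op phi f).

(** [g] belongs to S^n H^p. *)
Definition in_power_range (p : R) (S : (C -> C) -> (C -> C)) (n : nat)
    (g : C -> C) : Prop :=
  exists f, in_Hp p f /\ eq_on_disc g (Nat.iter n S f).

Record codim_one_isometry (p : R) (S : (C -> C) -> (C -> C)) : Prop := {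
  isom_ext : forall f g, in_Hp p f -> in_Hp p g ->
    eq_on_disc f g -> eq_on_disc (S f) (S g);
  isom_stable : forall f, in_Hp p f -> in_Hp p (S f);
  isom_linear : forall (c : C) f g, in_Hp p f -> in_Hp p g ->
    eq_on_disc (S (fun z => c * f z + g z)%C) (fun z => c * S f z + S g z)%C;
  isom_norm : forall f, in_Hp p f -> hardy_norm p (S f) = hardy_norm p f;
  isom_codim1 : exists h, in_Hp p h /\ ~ in_power_range p S 1 h /\
    forall g, in_Hp p g ->
      exists c : C, in_power_range p S 1 (fun z => g z - c * h z)%C }.

Definition Crownover (p : R) (S : (C -> C) -> (C -> C)) : Prop :=
  codim_one_isometry p S /\
  forall g, in_Hp p g ->
    ((forall n, (1 <= n)%nat -> in_power_range p S n g) <->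
     eq_on_disc g (fun _ => RtoC 0)).

(* Main.v *)
Require Import Defs.
From Stdlib Require Import Reals Lra Lia ClassicalEpsilon.
From Coquelicot Require Import Coquelicot.
Open Scope R_scope.

(** Write [S = M_psi U_phi] and let [alpha] be a fixed point of [phi] in the
    disc.

    The Crownover property comes from two estimates. If [g = S^n f], then
    [|g z|] is the product of the moduli of [psi] at [z], [phi z], ...,
    [phi^(n-1) z] times [|U^n f z|] ([Cmod_iter_MU_le]). By the Schwarz-Pick
    identity the orbit of [z] stays on a pseudo-hyperbolic circle about
    [alpha], hence in a compact subset of the disc, so the moduli of [psi] are
    bounded by some [rho < 1] ([orbit_bound]). As [S] and [U] are isometries,
    [U^n f] has the norm of [g], and point evaluations are bounded, so
    [|U^n f z| <= M] with [M] independent of [n]. Hence [|g z| <= rho^n M] for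
    all [n], and [g z = 0].

    Behind this stand three facts about Hardy spaces.

    The means of [|f|^p] increase with the radius ([pmean_mono]): [|f w|^p] is
    at most its Poisson average, by the Poisson formula and Jensen's
    inequality, and averaging over a circle with Fubini's theorem gives the
    claim. The Poisson formula is the Cauchy formula for [f] times a suitable
    kernel, and the Cauchy formula follows from Goursat's theorem on
    rectangles, transported to annuli by the exponential.

    [U_phi] is an isometry ([pmean_bound_U_iff]). It has an inverse of the same
    form, so it suffices that it does not increase norms. For functions
    holomorphic beyond the closed disc this is the change of variables
    [phi] on the unit circle ([RInt_aut_circle]), whose Jacobian is the modulus
    of the weight; the general case follows by dilation.

    [M_psi] is an isometry because [|psi|] tends to 1 at the boundary and the
    means increase ([pmean_bound_mul_iff]). Its range is the set of functions
    vanishing at the zero of [psi], because a holomorphic function is divisible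
    by [z - w] at a zero [w] ([hol_divide_root]); as [U_phi] is onto, [S] has
    the same range, which has codimension one. *)

(** * Continuity and differentiability of complex functions *)

(** [C] carries two uniform structures, that of the product [R * R] and that
    of the modulus; the first two notations fix the former, whichever
    structure unification would choose. *)
Notation ccont f x := (continuous (U := C_UniformSpace) f x).
Notation Ccont f z := (continuous (T := C_UniformSpace) (U := C_UniformSpace) f z).
Notation hol f z := (ex_derive (K := C_AbsRing) (V := C_NormedModule) f z).

Lemma ccont_pair {U : UniformSpace} (f : U -> C) (x : U) :
  ccont f x <->
  continuous (fun u => Re (f u)) x /\ continuous (fun u => Im (f u)) x.
Proof.
split.
- intros H; split.
  + apply (continuous_comp f (fun z : C_UniformSpace => fst z) x H).
    apply continuous_fst.
  + apply (continuous_comp f (fun z : C_UniformSpace => snd z) x H).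
    apply continuous_snd.
- intros [H1 H2].
  apply continuous_ext with (fun u => (Re (f u), Im (f u))).
  { intros u; unfold Re, Im; now destruct (f u). }
  apply (continuous_comp_2 (fun u => Re (f u)) (fun u => Im (f u))
    (fun a b => (a, b) : C_UniformSpace) x H1 H2).
  apply continuous_ext with (fun p : R * R => p).
  { now intros [a b]. }
  apply continuous_id.
Qed.

Section ContAlg.
Context {U : UniformSpace}.
Implicit Types (f g : U -> C) (h k : U -> R) (x : U).

Lemma cont_Rplus h k x :
  continuous h x -> continuous k x -> continuous (fun u => h u + k u) x.
Proof. intros H1 H2; exact (continuous_plus h k x H1 H2). Qed.

Lemma cont_Ropp h x : continuous h x -> continuous (fun u => - h u) x.
Proof. intros H1; exact (continuous_opp h x H1). Qed.

Lemma cont_Rminus h k x :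
  continuous h x -> continuous k x -> continuous (fun u => h u - k u) x.
Proof. intros H1 H2; exact (continuous_minus h k x H1 H2). Qed.

Lemma cont_Rmult h k x :
  continuous h x -> continuous k x -> continuous (fun u => h u * k u) x.
Proof. intros H1 H2; exact (continuous_mult h k x H1 H2). Qed.

Lemma cont_Rcomp (F : R -> R) h x :
  continuous F (h x) -> continuous h x -> continuous (fun u => F (h u)) x.
Proof. intros H1 H2; exact (continuous_comp h F x H2 H1). Qed.

Lemma cont_Rinv h x : h x <> 0 -> continuous h x -> continuous (fun u => / h u) x.
Proof. intros H0 H1; apply (cont_Rcomp Rinv h x); [ now apply continuous_Rinv | exact H1 ]. Qed.

Lemma cont_pow h n x : continuous h x -> continuous (fun u => h u ^ n) x.
Proof.
intros H; induction n as [|n IH]; simpl.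
- apply continuous_const.
- now apply cont_Rmult.
Qed.

Lemma ccont_Re f x : ccont f x -> continuous (fun u => Re (f u)) x.
Proof. now intros H; apply ccont_pair in H. Qed.

Lemma ccont_Im f x : ccont f x -> continuous (fun u => Im (f u)) x.
Proof. now intros H; apply ccont_pair in H. Qed.

Lemma ccont_RtoC h x : continuous h x -> ccont (fun u => RtoC (h u)) x.
Proof. intros H; apply ccont_pair; split; [ exact H | apply continuous_const ]. Qed.

Lemma ccont_mkpair h k x :
  continuous h x -> continuous k x -> ccont (fun u => (h u, k u) : C) x.
Proof. intros; now apply ccont_pair. Qed.

Lemma ccont_plus f g x : ccont f x -> ccont g x -> ccont (fun u => (f u + g u)%C) x.
Proof.
rewrite !ccont_pair; intros [A B] [C' D]; split;
  [ exact (cont_Rplus _ _ x A C') | exact (cont_Rplus _ _ x B D) ].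
Qed.

Lemma ccont_opp f x : ccont f x -> ccont (fun u => (- f u)%C) x.
Proof.
rewrite !ccont_pair; intros [A B]; split;
  [ exact (cont_Ropp _ x A) | exact (cont_Ropp _ x B) ].
Qed.

Lemma ccont_minus f g x : ccont f x -> ccont g x -> ccont (fun u => (f u - g u)%C) x.
Proof. intros; apply ccont_plus; [ easy | now apply ccont_opp ]. Qed.

Lemma ccont_mult f g x : ccont f x -> ccont g x -> ccont (fun u => (f u * g u)%C) x.
Proof.
rewrite !ccont_pair; intros [A B] [C' D]; split.
- apply (cont_Rminus (fun u => Re (f u) * Re (g u)) (fun u => Im (f u) * Im (g u)));
    now apply cont_Rmult.
- apply (cont_Rplus (fun u => Re (f u) * Im (g u)) (fun u => Im (f u) * Re (g u)));
    now apply cont_Rmult.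
Qed.

Lemma cont_Cmod f x : ccont f x -> continuous (fun u => Cmod (f u)) x.
Proof.
rewrite ccont_pair; intros [A B].
apply (cont_Rcomp sqrt (fun u => Re (f u) ^ 2 + Im (f u) ^ 2)).
- apply continuous_sqrt.
- apply cont_Rplus; now apply cont_pow.
Qed.

Lemma ccont_inv f x : f x <> 0%C -> ccont f x -> ccont (fun u => (/ f u)%C) x.
Proof.
rewrite !ccont_pair; intros H0 [A B].
assert (HN : Re (f x) ^ 2 + Im (f x) ^ 2 <> 0).
{ rewrite <- Cmod2_alt. apply pow_nonzero. intros E; now apply H0, Cmod_eq_0. }
assert (HI : continuous (fun u => / (Re (f u) ^ 2 + Im (f u) ^ 2)) x).
{ apply cont_Rinv; [ exact HN | apply cont_Rplus; now apply cont_pow ]. }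
split.
- exact (cont_Rmult _ _ x A HI).
- exact (cont_Rmult _ _ x (cont_Ropp _ x B) HI).
Qed.

Lemma ccont_div f g x :
  g x <> 0%C -> ccont f x -> ccont g x -> ccont (fun u => (f u / g u)%C) x.
Proof. intros; apply ccont_mult; [ easy | now apply ccont_inv ]. Qed.

Lemma ccont_const (c : C) x : ccont (fun _ : U => c) x.
Proof. apply continuous_const. Qed.

Lemma ccont_comp (F : C -> C) f x :
  continuous (T := C_UniformSpace) (U := C_UniformSpace) F (f x) -> ccont f x ->
  ccont (fun u => F (f u)) x.
Proof. intros H1 H2; exact (continuous_comp (V := C_UniformSpace) f F x H2 H1). Qed.

Lemma ccont_cis h x : continuous h x -> ccont (fun u => cis (h u)) x.
Proof.
intros H; apply ccont_mkpair; apply cont_Rcomp; auto.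
- apply continuous_cos.
- apply continuous_sin.
Qed.

End ContAlg.

(** The square neighbourhoods of the product and the round ones of the modulus
    generate the same filter, so estimates can be made with [Cmod]. *)
Lemma locally_Cmod (z : C) (P : C -> Prop) :
  locally (T := C_UniformSpace) z P <->
  exists d : posreal, forall w, Cmod (w - z) < d -> P w.
Proof.
rewrite locally_C; split; intros [d H]; exists d; intros w Hw; apply H; exact Hw.
Qed.

Lemma continuous_Cmod (f : C -> C) (z : C) :
  continuous (T := C_UniformSpace) (U := C_UniformSpace) f z <->
  forall eps : posreal, exists d : posreal,
    forall w, Cmod (w - z) < d -> Cmod (f w - f z) < eps.
Proof.
unfold continuous; split.
- intros H eps.
  specialize (H (fun y => Cmod (y - f z) < eps)).
  apply locally_Cmod. apply H. apply locally_Cmod. now exists eps.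
- intros H P HP. apply locally_Cmod in HP. destruct HP as [e He].
  destruct (H e) as [d Hd]. apply locally_Cmod. exists d; intros w Hw.
  apply He, Hd, Hw.
Qed.
(** Caratheodory's form of complex differentiability reduces the rules of
    calculus to the algebra of continuous functions. *)
Lemma is_derive_slope (f : C -> C) (z l : C) :
  is_derive (K := C_AbsRing) (V := C_NormedModule) f z l <->
  exists q : C -> C, Ccont q z /\ q z = l /\
    locally (T := C_UniformSpace) z (fun w => f w = (f z + q w * (w - z))%C).
Proof.
split.
- intros [_ Hl].
  specialize (Hl z (fun P H => H)).
  exists (fun w => if excluded_middle_informative (w = z) then l
                   else ((f w - f z) / (w - z))%C).
  split; [ | split ].
  + apply continuous_Cmod; intros eps.
    destruct (Hl (pos_div_2 eps)) as [d Hd]. exists d; intros w Hw.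
    destruct (excluded_middle_informative (z = z)) as [_|n]; [ | now destruct n ].
    destruct (excluded_middle_informative (w = z)) as [E|n].
    { replace (l - l)%C with (RtoC 0) by ring. rewrite Cmod_0. apply eps. }
    assert (Hn : (w - z)%C <> 0%C).
    { intros E; apply n. replace w with (w - z + z)%C by ring. rewrite E; ring. }
    specialize (Hd w Hw).
    change (Cmod ((f w - f z) - (w - z) * l)%C <= eps / 2 * Cmod (w - z)%C) in Hd.
    replace ((f w - f z) / (w - z) - l)%C
      with (((f w - f z) - (w - z) * l) / (w - z))%C by now field.
    rewrite Cmod_div by exact Hn.
    apply Cmod_gt_0 in Hn.
    apply Rle_lt_trans with (eps / 2).
    * apply Rle_div_l; lra.
    * destruct eps; simpl; lra.
  + destruct (excluded_middle_informative (z = z)) as [_|n]; [ easy | now destruct n ].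
  + apply locally_Cmod. exists (mkposreal 1 Rlt_0_1). intros w _.
    destruct (excluded_middle_informative (w = z)) as [->|n]; [ ring | ].
    field. intros E; apply n. replace w with (w - z + z)%C by ring. rewrite E; ring.
- intros [q [Hq [<- Hf]]].
  split.
  { apply is_linear_scal_l. }
  intros x Hx eps.
  assert (x = z) as ->.
  { symmetry; apply (is_filter_lim_locally_unique (V := AbsRing_NormedModule C_AbsRing) z x Hx). }
  apply locally_Cmod in Hf. destruct Hf as [d1 H1].
  destruct (proj1 (continuous_Cmod q z) Hq eps) as [d2 H2].
  assert (Hd : 0 < Rmin d1 d2) by (apply Rmin_pos; [ apply d1 | apply d2 ]).
  exists (mkposreal _ Hd); intros w Hw.
  change (Cmod (w - z)%C < Rmin d1 d2) in Hw.
  change (Cmod ((f w - f z) - (w - z) * q z)%C <= eps * Cmod (w - z)%C).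
  rewrite (H1 w) by (apply Rlt_le_trans with (1 := Hw), Rmin_l).
  replace (f z + q w * (w - z) - f z - (w - z) * q z)%C
    with ((q w - q z) * (w - z))%C by ring.
  rewrite Cmod_mult. apply Rmult_le_compat_r; [ apply Cmod_ge_0 | ].
  left; apply H2. apply Rlt_le_trans with (1 := Hw), Rmin_r.
Qed.

Lemma hol_iff (f : C -> C) (z : C) :
  hol f z <->
  exists q : C -> C, Ccont q z /\
    locally (T := C_UniformSpace) z (fun w => f w = (f z + q w * (w - z))%C).
Proof.
split.
- intros [l Hl]. apply is_derive_slope in Hl. destruct Hl as [q [H1 [_ H2]]]. now exists q.
- intros [q [H1 H2]]. exists (q z). apply is_derive_slope. now exists q.
Qed.

Lemma hol_cont (f : C -> C) (z : C) : hol f z -> Ccont f z.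
Proof.
intros H; apply hol_iff in H; destruct H as [q [Hq Hf]].
apply (continuous_ext_loc _ (fun w => f z + q w * (w - z))%C).
{ revert Hf; apply filter_imp; intros w ->; reflexivity. }
apply ccont_plus; [ apply ccont_const | apply ccont_mult; [ exact Hq | ] ].
apply ccont_minus; [ apply continuous_id | apply ccont_const ].
Qed.

Lemma hol_ext_loc (f g : C -> C) (z : C) :
  locally (T := C_UniformSpace) z (fun w => f w = g w) -> hol f z -> hol g z.
Proof.
intros E [l H]; exists l.
apply (is_derive_ext_loc f); [ | exact H ].
now apply locally_C in E.
Qed.

Lemma hol_ext (f g : C -> C) (z : C) : (forall w, f w = g w) -> hol f z -> hol g z.
Proof. intros E; apply hol_ext_loc. now apply filter_forall. Qed.

Lemma hol_const (c z : C) : hol (fun _ => c) z.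
Proof. apply ex_derive_const. Qed.

Lemma hol_id (z : C) : hol (fun w => w) z.
Proof.
apply hol_iff. exists (fun _ => RtoC 1); split; [ apply ccont_const | ].
apply filter_forall; intros w; change C in w; ring.
Qed.

Lemma hol_plus (f g : C -> C) (z : C) :
  hol f z -> hol g z -> hol (fun w => f w + g w)%C z.
Proof.
rewrite !hol_iff; intros [q [Hq Hf]] [s [Hs Hg]].
exists (fun w => q w + s w)%C; split; [ now apply ccont_plus | ].
generalize (filter_and _ _ Hf Hg); apply filter_imp; intros w [-> ->]; change C in w; ring.
Qed.

Lemma hol_mult (f g : C -> C) (z : C) :
  hol f z -> hol g z -> hol (fun w => f w * g w)%C z.
Proof.
intros H1 H2; generalize (hol_cont g z H2); revert H1 H2.
rewrite !hol_iff; intros [q [Hq Hf]] [s [Hs Hg]] Cg.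
exists (fun w => q w * g w + f z * s w)%C; split.
{ apply ccont_plus; apply ccont_mult; trivial; apply ccont_const. }
generalize (filter_and _ _ Hf Hg); apply filter_imp; intros w [-> ->]; change C in w; ring.
Qed.

Lemma hol_opp (f : C -> C) (z : C) : hol f z -> hol (fun w => - f w)%C z.
Proof.
intros H. apply (hol_ext (fun w => - (1) * f w)%C); [ intros; ring | ].
apply hol_mult; [ apply hol_const | exact H ].
Qed.

Lemma hol_minus (f g : C -> C) (z : C) :
  hol f z -> hol g z -> hol (fun w => f w - g w)%C z.
Proof. intros; apply hol_plus; [ easy | now apply hol_opp ]. Qed.

Lemma ccont_neq0 (f : C -> C) (z : C) :
  Ccont f z -> f z <> 0%C -> locally (T := C_UniformSpace) z (fun w => f w <> 0%C).
Proof.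
intros Hf H0. apply locally_Cmod.
assert (Hp : 0 < Cmod (f z)) by now apply Cmod_gt_0.
destruct (proj1 (continuous_Cmod f z) Hf (mkposreal _ Hp)) as [d Hd].
exists d; intros w Hw E. specialize (Hd w Hw). rewrite E in Hd. simpl in Hd.
replace (0 - f z)%C with (- f z)%C in Hd by ring. rewrite Cmod_opp in Hd. lra.
Qed.

Lemma hol_inv (f : C -> C) (z : C) :
  f z <> 0%C -> hol f z -> hol (fun w => / f w)%C z.
Proof.
intros H0 H; assert (Cf := hol_cont f z H); assert (N := ccont_neq0 f z Cf H0).
revert H; rewrite !hol_iff; intros [q [Hq Hf]].
exists (fun w => - q w / (f w * f z))%C; split.
{ apply ccont_div.
  - now apply Cmult_neq_0.
  - now apply ccont_opp.
  - apply ccont_mult; trivial; apply ccont_const. }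
generalize (filter_and _ _ Hf N); apply filter_imp; intros w [E Hw]; change C in w.
assert (E' : (q w * (w - z))%C = (f w - f z)%C) by (rewrite E at 1; ring).
transitivity (/ f z + - (q w * (w - z)) / (f w * f z))%C.
- rewrite E'; field; auto.
- field; auto.
Qed.

Lemma hol_div (f g : C -> C) (z : C) :
  g z <> 0%C -> hol f z -> hol g z -> hol (fun w => f w / g w)%C z.
Proof. intros; apply hol_mult; [ easy | now apply hol_inv ]. Qed.

Lemma hol_comp (f g : C -> C) (z : C) :
  hol f (g z) -> hol g z -> hol (fun w => f (g w)) z.
Proof.
intros H1 H2; assert (Cg := hol_cont g z H2); revert H1 H2.
rewrite !hol_iff; intros [q [Hq Hf]] [s [Hs Hg]].
exists (fun w => q (g w) * s w)%C; split.
{ apply ccont_mult; [ now apply (ccont_comp (U := C_UniformSpace)) | exact Hs ]. }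
assert (Hfg : locally (T := C_UniformSpace) z
  (fun w => f (g w) = (f (g z) + q (g w) * (g w - g z))%C)) by exact (Cg _ Hf).
generalize (filter_and _ _ Hfg Hg); apply filter_imp; intros w [H1 E]; change C in w.
rewrite H1. rewrite E at 2. ring.
Qed.

(** * Exponential and logarithm *)

Lemma cis_plus (s t : R) : cis (s + t) = (cis s * cis t)%C.
Proof.
unfold cis, Cmult; simpl. rewrite cos_plus, sin_plus. f_equal; ring.
Qed.

Lemma cis_0 : cis 0 = 1%C.
Proof. unfold cis. now rewrite cos_0, sin_0. Qed.

Lemma Cmod_cis (t : R) : Cmod (cis t) = 1.
Proof.
unfold Cmod, cis; simpl fst; simpl snd.
replace (cos t ^ 2 + sin t ^ 2) with 1
  by (generalize (sin2_cos2 t); unfold Rsqr; intros; lra).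
apply sqrt_1.
Qed.

Lemma Cconj_cis (t : R) : Cconj (cis t) = cis (- t).
Proof. unfold Cconj, cis; simpl. now rewrite cos_neg, sin_neg. Qed.

Lemma cis_opp_l (t : R) : (cis (- t) * cis t = 1)%C.
Proof. rewrite <- cis_plus, Rplus_opp_l. apply cis_0. Qed.

Lemma cis_period (t : R) : cis (t + 2 * PI) = cis t.
Proof. unfold cis. now rewrite cos_plus, sin_plus, cos_2PI, sin_2PI, !Rmult_0_r, !Rmult_1_r, Rminus_0_r, Rplus_0_r. Qed.

Lemma Cmod_le_l1 (x y : R) : Cmod (x, y) <= Rabs x + Rabs y.
Proof.
replace ((x, y) : C) with (RtoC x + Ci * RtoC y)%C
  by (apply injective_projections; simpl; ring).
eapply Rle_trans; [ apply Cmod_triangle | ].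
rewrite Cmod_mult, Cmod_Ci, !Cmod_R. lra.
Qed.

Lemma Ci_sqr : (Ci * Ci = - (1))%C.
Proof. apply injective_projections; simpl; ring. Qed.

Lemma Cconj_RtoC (r : R) : Cconj (RtoC r) = RtoC r.
Proof. apply injective_projections; simpl; ring. Qed.

Lemma Cmod_gt_0_Re (z : C) : 0 < Re z -> 0 < Cmod z.
Proof.
intros H. apply Rlt_le_trans with (1 := H).
apply Rle_trans with (2 := re_le_Cmod z). apply Rle_abs.
Qed.

Definition Cexp (z : C) : C := (RtoC (exp (Re z)) * cis (Im z))%C.

Lemma Cexp_plus (z w : C) : Cexp (z + w) = (Cexp z * Cexp w)%C.
Proof.
unfold Cexp. rewrite re_plus, im_plus, exp_plus, cis_plus, RtoC_mult. ring.
Qed.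

Lemma Cexp_0 : Cexp 0 = 1%C.
Proof. unfold Cexp; simpl. rewrite exp_0, cis_0. ring. Qed.

Lemma Cmod_Cexp (z : C) : Cmod (Cexp z) = exp (Re z).
Proof.
unfold Cexp. rewrite Cmod_mult, Cmod_cis, Cmod_R, Rmult_1_r.
apply Rabs_pos_eq; left; apply exp_pos.
Qed.

Lemma derive_0_bound (f : R -> R) (l : R) (eps : posreal) :
  is_derive f 0 l ->
  exists d : posreal, forall x, Rabs x < d -> Rabs (f x - f 0 - l * x) <= eps * Rabs x.
Proof.
intros [_ H]. specialize (H 0 (fun P H => H) eps).
destruct H as [d Hd]. exists d; intros x Hx.
specialize (Hd x). rewrite <- (Rminus_0_r x) at 3.
replace (f x - f 0 - l * x) with (f x - f 0 - (x - 0) * l) by ring.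
apply Hd. change (Rabs (x - 0) < d). now rewrite Rminus_0_r.
Qed.

Lemma Cexp_derive_0 : is_derive (K := C_AbsRing) (V := C_NormedModule) Cexp (RtoC 0) (RtoC 1).
Proof.
split.
{ apply is_linear_scal_l. }
intros x Hx eps.
assert (x = RtoC 0) as ->.
{ symmetry; apply (is_filter_lim_locally_unique (V := AbsRing_NormedModule C_AbsRing) _ x Hx). }
(* The three error terms below use one, three and two sixths of eps. *)
assert (He : 0 < eps / 6) by (destruct eps; simpl; lra).
assert (He1 : 0 < Rmin (eps / 6) 1) by (apply Rmin_pos; lra).
set (e := mkposreal _ He1).
destruct (derive_0_bound exp 1 e) as [d1 H1].
{ replace 1 with (exp 0) by apply exp_0. apply is_derive_exp. }
destruct (derive_0_bound cos 0 e) as [d2 H2].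
{ replace 0 with (- sin 0) at 2 by (rewrite sin_0; ring). apply is_derive_cos. }
destruct (derive_0_bound sin 1 e) as [d3 H3].
{ replace 1 with (cos 0) by apply cos_0. apply is_derive_sin. }
assert (Hd : 0 < Rmin (Rmin d1 (eps / 6)) (Rmin d2 d3)).
{ repeat apply Rmin_pos; try apply cond_pos; exact He. }
exists (mkposreal _ Hd). intros h Hh; change C in h.
change (Cmod (h - 0)%C < Rmin (Rmin d1 (eps / 6)) (Rmin d2 d3)) in Hh.
change (Cmod ((Cexp h - Cexp 0) - (h - 0) * 1)%C <= eps * Cmod (h - 0)%C).
assert (Eh : (h - 0)%C = h) by ring. rewrite Eh in Hh |- *. rewrite Cexp_0.
assert (Hh1 : Cmod h < d1 /\ Cmod h < eps / 6 /\ Cmod h < d2 /\ Cmod h < d3).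
{ revert Hh; generalize (Cmod h); intros c Hc.
  apply Rmin_Rgt in Hc. destruct Hc as [A B].
  apply Rmin_Rgt in A. apply Rmin_Rgt in B. tauto. }
destruct h as [x y]. unfold Cexp; simpl Re; simpl Im.
assert (Ax := re_le_Cmod (x, y)). simpl Re in Ax.
assert (Ay : Rabs y <= Cmod (x, y)).
{ apply Rle_trans with (2 := Rmax_Cmod (x, y)). apply Rmax_r. }
revert Ax Ay Hh1. generalize (Cmod_ge_0 (x, y)). generalize (Cmod (x, y)); intros c Hc Ax Ay Hh1.
specialize (H1 x ltac:(lra)). specialize (H2 y ltac:(lra)). specialize (H3 y ltac:(lra)).
rewrite exp_0 in H1. rewrite cos_0 in H2. rewrite sin_0 in H3.
rewrite Rmult_0_l, Rminus_0_r in H2. rewrite Rmult_1_l in *. rewrite Rminus_0_r in H3.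
pose (rem := (cos y - 1, sin y - y) : C).
replace (RtoC (exp x) * cis y - 1 - (x, y) * 1)%C
  with (RtoC (exp x - 1 - x) * cis y + (RtoC x * (cis y - 1) + rem))%C
  by (unfold rem, cis; apply injective_projections; simpl; ring).
eapply Rle_trans; [ apply Cmod_triangle | ].
assert (e <= eps / 6 /\ e <= 1) as [E1 E2].
{ unfold e; simpl; split; [ apply Rmin_l | apply Rmin_r ]. }
assert (E0 : 0 < e) by apply cond_pos.
assert (T1 : Cmod (RtoC (exp x - 1 - x) * cis y) <= eps / 6 * c).
{ rewrite Cmod_mult, Cmod_cis, Cmod_R, Rmult_1_r.
  eapply Rle_trans; [ exact H1 | ].
  apply Rmult_le_compat; [ lra | apply Rabs_pos | easy | easy ]. }
assert (T3 : Cmod rem <= 2 * (eps / 6) * c).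
{ eapply Rle_trans; [ apply Cmod_le_l1 | ].
  assert (e * Rabs y <= eps / 6 * c)
    by (apply Rmult_le_compat; [ lra | apply Rabs_pos | easy | easy ]).
  lra. }
assert (T2 : Cmod (RtoC x * (cis y - 1)) <= c * (3 * (eps / 6))).
{ rewrite Cmod_mult, Cmod_R.
  apply Rmult_le_compat; [ apply Rabs_pos | apply Cmod_ge_0 | exact Ax | ].
  replace (cis y - 1)%C with (rem + Ci * RtoC y)%C
    by (unfold rem, cis; apply injective_projections; simpl; ring).
  eapply Rle_trans; [ apply Cmod_triangle | ].
  rewrite Cmod_mult, Cmod_Ci, Cmod_R, Rmult_1_l.
  assert (Cmod rem <= Rabs (cos y - 1) + Rabs (sin y - y)) by apply Cmod_le_l1.
  assert (e * Rabs y <= 1 * Rabs y) by (apply Rmult_le_compat_r; [ apply Rabs_pos | easy ]).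
  lra. }
assert (T4 : Cmod (RtoC x * (cis y - 1) + rem)
          <= c * (3 * (eps / 6)) + 2 * (eps / 6) * c).
{ eapply Rle_trans; [ apply Cmod_triangle | lra ]. }
lra.
Qed.

Lemma Cexp_derive (z : C) : is_derive (K := C_AbsRing) (V := C_NormedModule) Cexp z (Cexp z).
Proof.
generalize Cexp_derive_0. rewrite !is_derive_slope. intros [q [Hq [E Hf]]].
exists (fun w => Cexp z * q (w - z))%C; split; [ | split ].
- apply ccont_mult; [ apply ccont_const | ].
  apply (ccont_comp (U := C_UniformSpace)).
  + now replace (z - z)%C with (RtoC 0) by ring.
  + apply ccont_minus; [ apply continuous_id | apply ccont_const ].
- replace (z - z)%C with (RtoC 0) by ring. rewrite E; ring.
- apply locally_Cmod in Hf. apply locally_Cmod. destruct Hf as [d Hd].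
  exists d; intros w Hw. specialize (Hd (w - z)%C).
  replace (w - z - 0)%C with (w - z)%C in Hd by ring.
  replace w with (z + (w - z))%C at 1 by ring.
  rewrite Cexp_plus, (Hd Hw), Cexp_0. ring.
Qed.

Lemma hol_Cexp (z : C) : hol Cexp z.
Proof. exists (Cexp z). apply Cexp_derive. Qed.

(** The argument only on the right half plane, which contains all the
    denominators [1 - conj a * z] of automorphisms. *)
Definition right_arg (z : C) : R := atan (Im z / Re z).

Definition Clog (z : C) : C := (ln (Cmod z), right_arg z).

Lemma right_arg_polar (z : C) :
  0 < Re z -> z = (RtoC (Cmod z) * cis (right_arg z))%C.
Proof.
destruct z as [x y]. unfold right_arg, cis, Cmod; simpl Re; simpl Im; simpl fst; simpl snd.
intros Hx. rewrite cos_atan, sin_atan.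
assert (E : sqrt (x ^ 2 + y ^ 2) = x * sqrt (1 + (y / x)²)).
{ rewrite <- (sqrt_Rsqr x) at 2 by lra. rewrite <- sqrt_mult; [ | apply Rle_0_sqr | ].
  - f_equal. unfold Rsqr. field. lra.
  - generalize (Rle_0_sqr (y / x)); lra. }
rewrite E.
assert (H : 0 < sqrt (1 + (y / x)²)).
{ apply sqrt_lt_R0. generalize (Rle_0_sqr (y / x)); lra. }
apply injective_projections; simpl; field; lra.
Qed.

Lemma Cexp_Clog (z : C) : 0 < Re z -> Cexp (Clog z) = z.
Proof.
intros H. unfold Cexp, Clog; simpl Re; simpl Im.
assert (P := Cmod_gt_0_Re z H).
rewrite exp_ln by easy. symmetry; now apply right_arg_polar.
Qed.

Lemma Clog_cont (z : C) : 0 < Re z -> Ccont Clog z.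
Proof.
intros H.
assert (P := Cmod_gt_0_Re z H).
assert (I : Ccont (fun w : C => w) z) by apply continuous_id.
apply ccont_mkpair.
- apply (cont_Rcomp ln Cmod).
  + now apply continuous_ln.
  + now apply (cont_Cmod (U := C_UniformSpace) (fun w => w)).
- apply (cont_Rcomp atan (fun w : C_UniformSpace => Im w / Re w)).
  + apply continuous_atan.
  + apply cont_Rmult; [ now apply (ccont_Im (U := C_UniformSpace) (fun w => w)) | ].
    apply cont_Rinv; [ lra | ]. now apply (ccont_Re (U := C_UniformSpace) (fun w => w)).
Qed.

(** The logarithm is a continuous right inverse of the exponential, whose
    derivative vanishes nowhere. *)
Lemma hol_Clog (z : C) : 0 < Re z -> hol Clog z.
Proof.
intros H. assert (CL := Clog_cont z H).
generalize (Cexp_derive (Clog z)). rewrite is_derive_slope, hol_iff.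
intros [q [Hq [E Hf]]].
assert (N0 : q (Clog z) <> 0%C).
{ rewrite E, Cexp_Clog by exact H. intros ->; simpl in H; lra. }
assert (Cq : Ccont (fun w => q (Clog w)) z) by now apply (ccont_comp (U := C_UniformSpace)).
exists (fun w => / q (Clog w))%C; split.
{ now apply ccont_inv. }
assert (Hf' : locally (T := C_UniformSpace) z (fun w =>
  Cexp (Clog w) = (Cexp (Clog z) + q (Clog w) * (Clog w - Clog z))%C)) by exact (CL _ Hf).
assert (P : locally (T := C_UniformSpace) z (fun w => 0 < Re w)).
{ apply (ccont_Re (U := C_UniformSpace) (fun w => w) z (continuous_id z) (fun x => 0 < x)).
  now apply open_gt. }
generalize (filter_and _ _ (filter_and _ _ Hf' P) (ccont_neq0 _ _ Cq N0)).
apply filter_imp; intros w [[F Pw] N]; change C in w.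
rewrite !Cexp_Clog in F by easy. assert (F' : (w - z)%C = (q (Clog w) * (Clog w - Clog z))%C) by (rewrite F at 1; ring).
rewrite F'. now field.
Qed.

(** * Integrals depending on a parameter *)

Lemma RInt_Rplus (f g : R -> R) (a b : R) : ex_RInt f a b -> ex_RInt g a b ->
  RInt (fun t => f t + g t) a b = RInt f a b + RInt g a b.
Proof. exact (RInt_plus f g a b). Qed.

Lemma RInt_Rminus (f g : R -> R) (a b : R) : ex_RInt f a b -> ex_RInt g a b ->
  RInt (fun t => f t - g t) a b = RInt f a b - RInt g a b.
Proof. exact (RInt_minus f g a b). Qed.

Lemma RInt_Rscal (f : R -> R) (k a b : R) : ex_RInt f a b ->
  RInt (fun t => k * f t) a b = k * RInt f a b.
Proof. exact (RInt_scal f a b k). Qed.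

Lemma ex_RInt_Rscal (f : R -> R) (k a b : R) : ex_RInt f a b ->
  ex_RInt (fun t => k * f t) a b.
Proof. exact (ex_RInt_scal f a b k). Qed.

Lemma ex_RInt_cont (f : R -> R) (a b : R) :
  (forall t, Rmin a b <= t <= Rmax a b -> continuous f t) -> ex_RInt f a b.
Proof. exact (ex_RInt_continuous f a b). Qed.

Lemma ex_RInt_cont_le (f : R -> R) (a b : R) :
  a <= b -> (forall t, a <= t <= b -> continuous f t) -> ex_RInt f a b.
Proof.
intros Hab H; apply ex_RInt_cont. now rewrite Rmin_left, Rmax_right.
Qed.

Lemma continuous_slice {U V W : UniformSpace} (F : U -> V -> W) (u : U) (v : V) :
  continuous (fun p : U * V => F (fst p) (snd p)) (u, v) -> continuous (F u) v.
Proof.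
intros H. apply (continuous_comp_2 (fun _ => u) (fun v => v) F v).
- apply continuous_const.
- apply continuous_id.
- exact H.
Qed.

(** Compactness of the interval of integration makes continuity in the
    parameter uniform in the variable of integration. *)
Lemma cont_RInt_param {U : UniformSpace} (F : U -> R -> R) (a b : R) (u0 : U) :
  (forall t, Rmin a b <= t <= Rmax a b ->
     continuous (fun p : U * R => F (fst p) (snd p)) (u0, t)) ->
  locally u0 (fun u => forall t, Rmin a b <= t <= Rmax a b -> continuous (F u) t) ->
  continuous (fun u => RInt (F u) a b) u0.
Proof.
intros Hj Hs. apply filterlim_locally; intros eps.
assert (He : 0 < eps / (2 * (Rabs (b - a) + 1))).
{ apply Rdiv_lt_0_compat; [ apply cond_pos | generalize (Rabs_pos (b - a)); lra ]. }
set (e := mkposreal _ He).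
assert (Hd : forall t, { d : posreal | Rmin a b <= t <= Rmax a b ->
   forall u s, ball u0 d u -> ball t d s -> Rabs (F u s - F u0 t) < e }).
{ intros t. apply constructive_indefinite_description.
  destruct (excluded_middle_informative (Rmin a b <= t <= Rmax a b)) as [Ht|Ht];
    [ | exists (mkposreal 1 Rlt_0_1); tauto ].
  destruct (proj1 (filterlim_locally _ _) (Hj t Ht) e) as [d H].
  exists d; intros _ u s Hu Hs'. apply (H (u, s)). now split. }
destruct (compactness_value_1d (Rmin a b) (Rmax a b) (fun t => proj1_sig (Hd t)))
  as [d Hcomp].
assert (Hb : locally u0 (fun u => ball u0 d u)) by (now exists d).
generalize (filter_and _ _ Hs Hb); apply filter_imp; intros u [Hu1 Hu2].
assert (Hs0 : forall t, Rmin a b <= t <= Rmax a b -> continuous (F u0) t).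
{ intros t Ht. now apply continuous_slice, Hj. }
change (Rabs (RInt (F u) a b - RInt (F u0) a b) < eps).
rewrite <- RInt_Rminus by now apply ex_RInt_cont.
assert (B : Rabs (RInt (fun t => F u t - F u0 t) a b) <= Rabs (b - a) * (2 * e)).
{ apply (norm_RInt_le_const_abs (fun t => F u t - F u0 t) a b).
  - intros x Hx. apply Rnot_lt_le. intros Hc.
    apply (Hcomp x Hx). intros [t [Ht [Hxt Hdt]]].
    destruct (Hd t) as [dt H]. simpl in Hxt, Hdt.
    assert (A1 : Rabs (F u x - F u0 t) < e).
    { apply H; [ easy | now apply ball_le with (1 := Hdt) | exact Hxt ]. }
    assert (A2 : Rabs (F u0 x - F u0 t) < e).
    { apply H; [ easy | apply ball_center | exact Hxt ]. }
    revert Hc. change (2 * e < Rabs (F u x - F u0 x) -> False).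
    replace (F u x - F u0 x) with ((F u x - F u0 t) - (F u0 x - F u0 t)) by ring.
    intros Hc. generalize (Rabs_triang (F u x - F u0 t) (- (F u0 x - F u0 t))).
    rewrite Rabs_Ropp. unfold Rminus in *. lra.
  - apply (RInt_correct (fun t => F u t - F u0 t)).
    apply ex_RInt_cont. intros t Ht.
    apply (cont_Rminus (F u) (F u0)); auto. }
apply Rle_lt_trans with (1 := B). unfold e; simpl.
set (L := Rabs (b - a)). assert (0 <= L) by apply Rabs_pos.
replace (L * (2 * (eps / (2 * (L + 1))))) with (eps * (L / (L + 1))) by (field; lra).
rewrite <- (Rmult_1_r eps) at 2. apply Rmult_lt_compat_l; [ apply cond_pos | ].
apply Rlt_div_l; lra.
Qed.

(** As functions of the upper limit [b], both sides have the derivative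
    [RInt (F b) c d]. *)
Lemma RInt_Fubini (F : R -> R -> R) (a b c d : R) :
  (forall x y, continuous (fun p : R * R => F (fst p) (snd p)) (x, y)) ->
  RInt (fun x => RInt (F x) c d) a b = RInt (fun y => RInt (fun x => F x y) a b) c d.
Proof.
intros HF.
assert (Hsw : forall x y, continuous (fun p : R * R => F (snd p) (fst p)) (x, y)).
{ intros x y. apply (continuous_comp_2 (fun p : R * R => snd p) (fun p : R * R => fst p) F).
  - apply continuous_snd.
  - apply continuous_fst.
  - apply HF. }
assert (H1 : forall x y, continuous (F x) y) by (intros; now apply continuous_slice).
assert (H2 : forall x y, continuous (fun u => F u y) x).
{ intros x y. exact (continuous_slice (fun v u => F u v) y x (Hsw y x)). }
pose (G := fun z y => RInt (fun u => F u y) a z).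
assert (HG : forall z y, continuous (G z) y).
{ intros z y. apply (cont_RInt_param (fun v u => F u v)).
  - intros t _. apply Hsw.
  - apply filter_forall; intros v t _. apply H2. }
assert (DG : forall z y, is_derive (fun z => G z y) z (F z y)).
{ intros z y. apply (is_derive_RInt (fun u => F u y)) with a.
  - apply filter_forall; intros x. apply (RInt_correct (fun u => F u y)).
    apply ex_RInt_cont; intros; apply H2.
  - apply H2. }
pose (Phi := fun z => RInt (G z) c d).
assert (DPhi : forall z, is_derive Phi z (RInt (F z) c d)).
{ intros z. replace (RInt (F z) c d) with (RInt (fun t => Derive (fun u => G u t) z) c d).
  - apply (is_derive_RInt_param G c d z).
    + apply filter_forall; intros x t _. exists (F x t). apply DG.
    + intros t _. apply continuity_2d_pt_ext with F.
      * intros x y. symmetry. now apply is_derive_unique.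
      * apply continuity_2d_pt_filterlim. apply HF.
    + apply filter_forall; intros x. apply ex_RInt_cont; intros; apply HG.
  - apply RInt_ext; intros t _. now apply is_derive_unique. }
assert (E : RInt (fun x => RInt (F x) c d) a b = minus (Phi b) (Phi a)).
{ apply is_RInt_unique, is_RInt_derive.
  - intros x _. apply DPhi.
  - intros x _. apply (cont_RInt_param F).
    + intros; apply HF.
    + apply filter_forall; intros; apply H1. }
rewrite E. replace (Phi a) with 0.
- change (Phi b - 0 = Phi b). ring.
- unfold Phi, G. rewrite (RInt_ext _ (fun _ => 0)).
  + rewrite RInt_const. symmetry; apply Rmult_0_r.
  + intros; apply (RInt_point (V := R_CompleteNormedModule)).
Qed.

(** * Integrals of complex functions of a real variable *)

Definition CInt (f : R -> C) (a b : R) : C :=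
  (RInt (fun t => Re (f t)) a b, RInt (fun t => Im (f t)) a b).

Definition ccont_on (f : R -> C) (a b : R) : Prop :=
  forall t, a <= t <= b -> ccont f t.

Section CInt.
Variables a b : R.
Hypothesis Hab : a <= b.

Lemma ex_RInt_Re f : ccont_on f a b -> ex_RInt (fun t => Re (f t)) a b.
Proof. intros H; apply ex_RInt_cont_le; [ easy | ]; intros; now apply (ccont_Re f), H. Qed.

Lemma ex_RInt_Im f : ccont_on f a b -> ex_RInt (fun t => Im (f t)) a b.
Proof. intros H; apply ex_RInt_cont_le; [ easy | ]; intros; now apply (ccont_Im f), H. Qed.

Lemma ex_RInt_Cmod f : ccont_on f a b -> ex_RInt (fun t => Cmod (f t)) a b.
Proof. intros H; apply ex_RInt_cont_le; [ easy | ]; intros; now apply (cont_Cmod f), H. Qed.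

Lemma CInt_ext f g : (forall t, a <= t <= b -> f t = g t) -> CInt f a b = CInt g a b.
Proof.
intros H; unfold CInt; f_equal; apply RInt_ext; intros t;
  rewrite Rmin_left, Rmax_right by easy; intros Ht; now rewrite H by lra.
Qed.

Lemma CInt_plus f g : ccont_on f a b -> ccont_on g a b ->
  CInt (fun t => f t + g t)%C a b = (CInt f a b + CInt g a b)%C.
Proof.
intros Hf Hg. apply injective_projections; simpl.
- apply (RInt_Rplus (fun t => Re (f t)) (fun t => Re (g t))); now apply ex_RInt_Re.
- apply (RInt_Rplus (fun t => Im (f t)) (fun t => Im (g t))); now apply ex_RInt_Im.
Qed.

Lemma CInt_scal (c : C) f : ccont_on f a b ->
  CInt (fun t => c * f t)%C a b = (c * CInt f a b)%C.
Proof.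
intros Hf.
assert (H1 := ex_RInt_Re f Hf). assert (H2 := ex_RInt_Im f Hf).
apply injective_projections; simpl.
- rewrite <- (RInt_Rscal _ (fst c) a b H1), <- (RInt_Rscal _ (snd c) a b H2).
  apply (RInt_Rminus (fun t => fst c * Re (f t)) (fun t => snd c * Im (f t)));
    now apply ex_RInt_Rscal.
- rewrite <- (RInt_Rscal _ (snd c) a b H1), <- (RInt_Rscal _ (fst c) a b H2).
  apply (RInt_Rplus (fun t => fst c * Im (f t)) (fun t => snd c * Re (f t)));
    now apply ex_RInt_Rscal.
Qed.

Lemma CInt_minus f g : ccont_on f a b -> ccont_on g a b ->
  CInt (fun t => f t - g t)%C a b = (CInt f a b - CInt g a b)%C.
Proof.
intros Hf Hg.
rewrite (CInt_ext _ (fun t => f t + - (1) * g t)%C) by (intros; ring).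
rewrite CInt_plus, CInt_scal; trivial.
- ring.
- intros t Ht. apply ccont_mult; [ apply ccont_const | now apply Hg ].
Qed.

Lemma CInt_const (c : C) : CInt (fun _ => c) a b = (RtoC (b - a) * c)%C.
Proof.
unfold CInt. rewrite !RInt_const. apply injective_projections; simpl;
  unfold scal; simpl; unfold mult; simpl; unfold Re, Im; ring.
Qed.

(** Rotating the value of the integral onto the positive axis reduces the
    estimate to real parts. *)
Lemma Cmod_CInt_le f : ccont_on f a b ->
  Cmod (CInt f a b) <= RInt (fun t => Cmod (f t)) a b.
Proof.
intros Hf. set (I := CInt f a b).
destruct (Req_dec (Cmod I) 0) as [E|N].
{ rewrite E. apply RInt_ge_0; [ easy | now apply ex_RInt_Cmod | ]. intros; apply Cmod_ge_0. }
assert (P : 0 < Cmod I) by (generalize (Cmod_ge_0 I); lra).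
apply Rmult_le_reg_l with (1 := P).
assert (E : Cmod I * Cmod I = Re (CInt (fun t => Cconj I * f t)%C a b)).
{ rewrite CInt_scal by easy. fold I.
  replace (Cconj I * I)%C with (RtoC (Cmod I ^ 2)) by (rewrite Cmod2_conj; ring).
  simpl. ring. }
rewrite E. unfold CInt; simpl Re at 1.
assert (S : RInt (fun t => Cmod I * Cmod (f t)) a b = Cmod I * RInt (fun t => Cmod (f t)) a b).
{ now apply RInt_Rscal, ex_RInt_Cmod. }
rewrite <- S.
assert (H' : ccont_on (fun t => Cconj I * f t)%C a b).
{ intros t Ht. apply ccont_mult; [ apply ccont_const | now apply Hf ]. }
apply RInt_le; [ exact Hab | exact (ex_RInt_Re _ H') | | ].
- now apply ex_RInt_Rscal, ex_RInt_Cmod.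
- intros t _. rewrite <- (Cmod_conj I), <- Cmod_mult.
  apply Rle_trans with (2 := re_le_Cmod (Cconj I * f t)). apply Rle_abs.
Qed.

Lemma Cmod_CInt_le_const f (M : R) : ccont_on f a b ->
  (forall t, a <= t <= b -> Cmod (f t) <= M) -> Cmod (CInt f a b) <= (b - a) * M.
Proof.
intros Hf HM. apply Rle_trans with (1 := Cmod_CInt_le f Hf).
replace ((b - a) * M) with (RInt (fun _ => M) a b) by (rewrite RInt_const; reflexivity).
apply RInt_le; [ easy | now apply ex_RInt_Cmod | apply ex_RInt_const | ].
intros t Ht; apply HM; lra.
Qed.

Lemma CInt_affine (u v : C) :
  CInt (fun t => u + RtoC t * v)%C a b
  = (RtoC (b - a) * u + RtoC ((b * b - a * a) / 2) * v)%C.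
Proof.
assert (L : forall x y, RInt (fun t => x + t * y) a b = (b - a) * x + (b * b - a * a) / 2 * y).
{ intros x y. apply is_RInt_unique.
  replace ((b - a) * x + (b * b - a * a) / 2 * y)
    with (minus ((fun t => t * x + t * t / 2 * y) b) ((fun t => t * x + t * t / 2 * y) a)).
  - apply (is_RInt_derive (fun t => t * x + t * t / 2 * y) (fun t => x + t * y)).
    + intros t _. auto_derive; [ easy | field ].
    + intros t _. apply (cont_Rplus (fun _ => x) (fun t => t * y)); [ apply continuous_const | ].
      apply (cont_Rmult (fun t => t) (fun _ => y)); [ apply continuous_id | apply continuous_const ].
  - unfold minus, plus, opp; simpl. field. }
unfold CInt. apply injective_projections; simpl.
- rewrite (RInt_ext _ (fun t => fst u + t * fst v)) by (intros; unfold Re; simpl; ring).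
  rewrite L; ring.
- rewrite (RInt_ext _ (fun t => snd u + t * snd v)) by (intros; unfold Im; simpl; ring).
  rewrite L; ring.
Qed.

End CInt.

Lemma CInt_Chasles (f : R -> C) (a b c : R) : a <= b <= c -> ccont_on f a c ->
  CInt f a c = (CInt f a b + CInt f b c)%C.
Proof.
intros H Hf.
assert (H1 : ccont_on f a b) by (intros t Ht; apply Hf; lra).
assert (H2 : ccont_on f b c) by (intros t Ht; apply Hf; lra).
apply injective_projections; symmetry.
- apply (RInt_Chasles (fun t => Re (f t)) a b c); now apply ex_RInt_Re.
- apply (RInt_Chasles (fun t => Im (f t)) a b c); now apply ex_RInt_Im.
Qed.

Lemma ccont_CInt_param {U : UniformSpace} (F : U -> R -> C) (a b : R) (u0 : U) :
  a <= b ->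
  (forall t, a <= t <= b -> ccont (fun p : U * R => F (fst p) (snd p)) (u0, t)) ->
  locally u0 (fun u => ccont_on (F u) a b) ->
  ccont (fun u => CInt (F u) a b) u0.
Proof.
intros Hab Hj Hs.
apply ccont_mkpair.
- apply (cont_RInt_param (fun u t => Re (F u t))); rewrite Rmin_left, Rmax_right by easy.
  + intros t Ht. now apply (ccont_Re (fun p : U * R => F (fst p) (snd p))), Hj.
  + revert Hs; apply filter_imp; intros u H t Ht. now apply (ccont_Re (F u)), H.
- apply (cont_RInt_param (fun u t => Im (F u t))); rewrite Rmin_left, Rmax_right by easy.
  + intros t Ht. now apply (ccont_Im (fun p : U * R => F (fst p) (snd p))), Hj.
  + revert Hs; apply filter_imp; intros u H t Ht. now apply (ccont_Im (F u)), H.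
Qed.

(** * Goursat's theorem on rectangles *)

Lemma nested_halves (X : nat -> R) (w : R) : 0 <= w ->
  (forall n, X n <= X (S n) <= X n + w / 2 ^ S n) ->
  exists a, forall n, X n <= a <= X n + w / 2 ^ n.
Proof.
intros Hw H.
assert (Hhalf : forall n, w / 2 ^ n = w / 2 ^ S n + w / 2 ^ S n).
{ intros n. simpl. field. apply pow_nonzero; lra. }
assert (Hpos : forall n, 0 <= w / 2 ^ n).
{ intros n. apply Rdiv_le_0_compat; [ easy | apply pow_lt; lra ]. }
assert (Hm : forall n k, X n <= X (n + k)%nat).
{ intros n k; induction k as [|k IH].
  - rewrite Nat.add_0_r; lra.
  - rewrite Nat.add_succ_r. specialize (H (n + k)%nat). lra. }
assert (Hd : forall n k, X (n + k)%nat + w / 2 ^ (n + k) <= X n + w / 2 ^ n).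
{ intros n k; induction k as [|k IH].
  - rewrite Nat.add_0_r; lra.
  - rewrite Nat.add_succ_r. specialize (H (n + k)%nat). specialize (Hhalf (n + k)%nat). lra. }
assert (Hmn : forall m n, X m <= X n + w / 2 ^ n).
{ intros m n. destruct (Nat.le_ge_cases m n) as [L|L].
  - replace n with (m + (n - m))%nat by lia.
    generalize (Hm m (n - m)%nat) (Hpos (m + (n - m))%nat); lra.
  - replace m with (n + (m - n))%nat by lia.
    generalize (Hd n (m - n)%nat) (Hpos (n + (m - n))%nat); lra. }
destruct (completeness (fun x => exists n, x = X n)) as [a [Ha1 Ha2]].
- exists (X 0%nat + w / 2 ^ 0). intros x [n ->]. apply Hmn.
- exists (X 0%nat). now exists 0%nat.
- exists a; intros n; split.
  + apply Ha1. now exists n.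
  + apply Ha2. intros x [m ->]. apply Hmn.
Qed.

(** Divide and conquer: a property of rectangles that is inherited from the
    four quarters and holds for all small rectangles around any given point
    holds for every rectangle. *)
Lemma rectangle_bisection (P : R -> R -> R -> R -> Prop) :
  (forall x y w h, 0 <= w -> 0 <= h ->
     P x y (w / 2) (h / 2) -> P (x + w / 2) y (w / 2) (h / 2) ->
     P x (y + h / 2) (w / 2) (h / 2) -> P (x + w / 2) (y + h / 2) (w / 2) (h / 2) ->
     P x y w h) ->
  (forall a b, exists d : posreal, forall x y w h,
     x <= a <= x + w -> y <= b <= y + h -> w < d -> h < d -> P x y w h) ->
  forall x y w h, 0 <= w -> 0 <= h -> P x y w h.
Proof.
intros Hsplit Hloc x y w h Hw Hh.
destruct (classic (P x y w h)) as [|Hn]; [ easy | exfalso ].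
pose (B := fun n (p : R * R) => ~ P (fst p) (snd p) (w / 2 ^ n) (h / 2 ^ n)).
assert (Hstep : forall n (p : {p | B n p}), exists p', B (S n) p' /\
  fst (proj1_sig p) <= fst p' <= fst (proj1_sig p) + w / 2 ^ S n /\
  snd (proj1_sig p) <= snd p' <= snd (proj1_sig p) + h / 2 ^ S n).
{ intros n [[u v] Hp]; unfold B in *; simpl fst in *; simpl snd in *; simpl proj1_sig.
  assert (E1 : w / 2 ^ S n = w / 2 ^ n / 2) by (simpl; field; apply pow_nonzero; lra).
  assert (E2 : h / 2 ^ S n = h / 2 ^ n / 2) by (simpl; field; apply pow_nonzero; lra).
  assert (0 <= w / 2 ^ n) by (apply Rdiv_le_0_compat; [ easy | apply pow_lt; lra ]).
  assert (0 <= h / 2 ^ n) by (apply Rdiv_le_0_compat; [ easy | apply pow_lt; lra ]).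
  rewrite E1, E2. set (w' := w / 2 ^ n) in *. set (h' := h / 2 ^ n) in *.
  assert (G : forall u' v', u <= u' <= u + w' / 2 -> v <= v' <= v + h' / 2 ->
    ~ P u' v' (w' / 2) (h' / 2) ->
    exists p' : R * R, ~ P (fst p') (snd p') (w' / 2) (h' / 2) /\
     u <= fst p' <= u + w' / 2 /\ v <= snd p' <= v + h' / 2).
  { intros u' v' Hu Hv Hnp. now exists (u', v'). }
  destruct (classic (P u v (w' / 2) (h' / 2))) as [A1|A1];
    [ | apply (G u v ltac:(lra) ltac:(lra) A1) ].
  destruct (classic (P (u + w' / 2) v (w' / 2) (h' / 2))) as [A2|A2];
    [ | apply (G (u + w' / 2) v ltac:(lra) ltac:(lra) A2) ].
  destruct (classic (P u (v + h' / 2) (w' / 2) (h' / 2))) as [A3|A3];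
    [ | apply (G u (v + h' / 2) ltac:(lra) ltac:(lra) A3) ].
  destruct (classic (P (u + w' / 2) (v + h' / 2) (w' / 2) (h' / 2))) as [A4|A4];
    [ | apply (G (u + w' / 2) (v + h' / 2) ltac:(lra) ltac:(lra) A4) ].
  exfalso; apply Hp, Hsplit; easy. }
assert (H0 : B 0%nat (x, y)).
{ unfold B; simpl. now replace (w / 1) with w by field; replace (h / 1) with h by field. }
pose (next := fun n (p : {p | B n p}) =>
  constructive_indefinite_description _ (Hstep n p)).
pose (box := fix box n : {p | B n p} := match n with
  | O => exist _ (x, y) H0
  | S m => exist _ (proj1_sig (next m (box m))) (proj1 (proj2_sig (next m (box m))))
  end).
assert (HS : forall n, fst (proj1_sig (box n)) <= fst (proj1_sig (box (S n)))
                 <= fst (proj1_sig (box n)) + w / 2 ^ S n /\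
  snd (proj1_sig (box n)) <= snd (proj1_sig (box (S n))) <= snd (proj1_sig (box n)) + h / 2 ^ S n).
{ intros n. exact (proj2 (proj2_sig (next n (box n)))). }
destruct (nested_halves (fun n => fst (proj1_sig (box n))) w Hw (fun n => proj1 (HS n))) as [a Ha].
destruct (nested_halves (fun n => snd (proj1_sig (box n))) h Hh (fun n => proj2 (HS n))) as [b Hb].
destruct (Hloc a b) as [d Hd].
assert (Hsm : forall c, 0 <= c -> exists N, forall n, (N <= n)%nat -> c / 2 ^ n < d).
{ intros c Hc.
  destruct (pow_lt_1_zero (/ 2) ltac:(rewrite Rabs_pos_eq; lra) (d / (c + 1))) as [N HN].
  { apply Rdiv_lt_0_compat; [ apply cond_pos | lra ]. }
  exists N; intros n HNn. specialize (HN n HNn).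
  rewrite Rabs_pos_eq in HN by (apply pow_le; lra).
  rewrite pow_inv in HN. unfold Rdiv.
  apply Rlt_div_r in HN; [ | lra ].
  apply Rle_lt_trans with (/ 2 ^ n * (c + 1)); [ | exact HN ].
  assert (0 < / 2 ^ n) by (apply Rinv_0_lt_compat, pow_lt; lra). nra. }
destruct (Hsm w Hw) as [N1 HN1]. destruct (Hsm h Hh) as [N2 HN2].
set (n := (N1 + N2)%nat).
apply (proj2_sig (box n)). apply Hd; auto.
- apply HN1; unfold n; lia.
- apply HN2; unfold n; lia.
Qed.

Definition in_rect (x1 x2 y1 y2 : R) (z : C) : Prop :=
  x1 <= Re z <= x2 /\ y1 <= Im z <= y2.

(** The integral of [g] along the boundary of the rectangle. *)
Definition rect_int (g : C -> C) (x1 x2 y1 y2 : R) : C :=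
  (CInt (fun u => g (u, y1)) x1 x2 + Ci * CInt (fun v => g (x2, v)) y1 y2
   - CInt (fun u => g (u, y2)) x1 x2 - Ci * CInt (fun v => g (x1, v)) y1 y2)%C.

Definition ccont_rect (g : C -> C) (x1 x2 y1 y2 : R) : Prop :=
  forall z, in_rect x1 x2 y1 y2 z -> Ccont g z.

Lemma ccont_hside (g : C -> C) x1 x2 y1 y2 y : ccont_rect g x1 x2 y1 y2 -> y1 <= y <= y2 ->
  ccont_on (fun u => g (u, y)) x1 x2.
Proof.
intros H Hy t Ht. apply (ccont_comp g (fun u => (u, y))).
- now apply H.
- apply ccont_mkpair; [ apply continuous_id | apply continuous_const ].
Qed.

Lemma ccont_vside (g : C -> C) x1 x2 y1 y2 x : ccont_rect g x1 x2 y1 y2 -> x1 <= x <= x2 ->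
  ccont_on (fun v => g (x, v)) y1 y2.
Proof.
intros H Hy t Ht. apply (ccont_comp g (fun v => (x, v))).
- now apply H.
- apply ccont_mkpair; [ apply continuous_const | apply continuous_id ].
Qed.

Lemma rect_int_split (g : C -> C) x1 xm x2 y1 ym y2 :
  x1 <= xm <= x2 -> y1 <= ym <= y2 -> ccont_rect g x1 x2 y1 y2 ->
  rect_int g x1 x2 y1 y2 =
  (rect_int g x1 xm y1 ym + rect_int g xm x2 y1 ym
   + rect_int g x1 xm ym y2 + rect_int g xm x2 ym y2)%C.
Proof.
intros Hx Hy Hg. unfold rect_int.
rewrite (CInt_Chasles (fun u => g (u, y1)) x1 xm x2) by
  (trivial; apply (ccont_hside g x1 x2 y1 y2); trivial; lra).
rewrite (CInt_Chasles (fun u => g (u, y2)) x1 xm x2) by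
  (trivial; apply (ccont_hside g x1 x2 y1 y2); trivial; lra).
rewrite (CInt_Chasles (fun v => g (x1, v)) y1 ym y2) by
  (trivial; apply (ccont_vside g x1 x2 y1 y2); trivial; lra).
rewrite (CInt_Chasles (fun v => g (x2, v)) y1 ym y2) by
  (trivial; apply (ccont_vside g x1 x2 y1 y2); trivial; lra).
ring.
Qed.

Lemma rect_int_ext g k x1 x2 y1 y2 : x1 <= x2 -> y1 <= y2 ->
  (forall z, in_rect x1 x2 y1 y2 z -> g z = k z) ->
  rect_int g x1 x2 y1 y2 = rect_int k x1 x2 y1 y2.
Proof.
intros Hx Hy H. unfold rect_int.
assert (E : forall y, y1 <= y <= y2 ->
  CInt (fun u => g (u, y)) x1 x2 = CInt (fun u => k (u, y)) x1 x2).
{ intros y Hy'; apply CInt_ext; trivial; intros t Ht; apply H; unfold in_rect; simpl; lra. }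
assert (E' : forall x, x1 <= x <= x2 ->
  CInt (fun v => g (x, v)) y1 y2 = CInt (fun v => k (x, v)) y1 y2).
{ intros x Hx'; apply CInt_ext; trivial; intros t Ht; apply H; unfold in_rect; simpl; lra. }
now rewrite !E, !E' by lra.
Qed.

Lemma rect_int_plus g k x1 x2 y1 y2 : x1 <= x2 -> y1 <= y2 ->
  ccont_rect g x1 x2 y1 y2 -> ccont_rect k x1 x2 y1 y2 ->
  rect_int (fun z => g z + k z)%C x1 x2 y1 y2
  = (rect_int g x1 x2 y1 y2 + rect_int k x1 x2 y1 y2)%C.
Proof.
intros Hx Hy Hg Hk. unfold rect_int.
rewrite !CInt_plus; trivial; try ring;
  (apply (ccont_hside _ x1 x2 y1 y2) || apply (ccont_vside _ x1 x2 y1 y2)); trivial; lra.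
Qed.

Lemma rect_int_affine (u v : C) x1 x2 y1 y2 : x1 <= x2 -> y1 <= y2 ->
  rect_int (fun z => u + z * v)%C x1 x2 y1 y2 = 0%C.
Proof.
intros Hx Hy. unfold rect_int.
assert (H : forall y, CInt (fun t => u + (t, y) * v)%C x1 x2
  = CInt (fun t => (u + Ci * RtoC y * v) + RtoC t * v)%C x1 x2).
{ intros y; apply CInt_ext; trivial; intros t _.
  replace ((t, y) : C) with (RtoC t + Ci * RtoC y)%C; [ ring | ].
  apply injective_projections; simpl; ring. }
assert (V : forall x, CInt (fun t => u + (x, t) * v)%C y1 y2
  = CInt (fun t => (u + RtoC x * v) + RtoC t * (Ci * v))%C y1 y2).
{ intros x; apply CInt_ext; trivial; intros t _.
  replace ((x, t) : C) with (RtoC x + Ci * RtoC t)%C; [ ring | ].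
  apply injective_projections; simpl; ring. }
rewrite !H, !V, !CInt_affine by easy.
unfold Rdiv. rewrite !RtoC_minus, !RtoC_mult, !RtoC_minus, !RtoC_mult.
assert (I2 := Ci_sqr).
ring [I2].
Qed.

Lemma Cmod_rect_int_le g (M : R) x1 x2 y1 y2 : x1 <= x2 -> y1 <= y2 ->
  ccont_rect g x1 x2 y1 y2 -> (forall z, in_rect x1 x2 y1 y2 z -> Cmod (g z) <= M) ->
  Cmod (rect_int g x1 x2 y1 y2) <= 2 * ((x2 - x1) + (y2 - y1)) * M.
Proof.
intros Hx Hy Hg HM.
assert (A : forall y, y1 <= y <= y2 -> Cmod (CInt (fun u => g (u, y)) x1 x2) <= (x2 - x1) * M).
{ intros y Hy'. apply Cmod_CInt_le_const; trivial.
  - now apply (ccont_hside _ x1 x2 y1 y2).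
  - intros t Ht; apply HM; unfold in_rect; simpl; lra. }
assert (B : forall x, x1 <= x <= x2 -> Cmod (Ci * CInt (fun v => g (x, v)) y1 y2) <= (y2 - y1) * M).
{ intros x Hx'. rewrite Cmod_mult, Cmod_Ci, Rmult_1_l. apply Cmod_CInt_le_const; trivial.
  - now apply (ccont_vside _ x1 x2 y1 y2).
  - intros t Ht; apply HM; unfold in_rect; simpl; lra. }
unfold rect_int.
eapply Rle_trans; [ apply Cmod_triangle | ]. rewrite Cmod_opp.
eapply Rle_trans; [ apply Rplus_le_compat_r, Cmod_triangle | ]. rewrite Cmod_opp.
eapply Rle_trans; [ apply Rplus_le_compat_r, Rplus_le_compat_r, Cmod_triangle | ].
generalize (A y1 ltac:(lra)) (A y2 ltac:(lra)) (B x1 ltac:(lra)) (B x2 ltac:(lra)). lra.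
Qed.

(** On a small rectangle [g] is affine up to an error of second order, and
    affine functions have zero boundary integral; bisection propagates the
    resulting bound [eps * (w + h) ^ 2], which is additive under quartering. *)
Theorem Goursat (g : C -> C) (x1 x2 y1 y2 : R) : x1 <= x2 -> y1 <= y2 ->
  (forall z, in_rect x1 x2 y1 y2 z -> hol g z) -> rect_int g x1 x2 y1 y2 = 0%C.
Proof.
intros Hx Hy Hg.
assert (Cg : forall x y w h, x1 <= x -> x + w <= x2 -> y1 <= y -> y + h <= y2 ->
  ccont_rect g x (x + w) y (y + h)).
{ intros x y w h A1 A2 A3 A4 z [B1 B2]. apply hol_cont, Hg. split; lra. }
assert (Main : forall eps : posreal, forall x y w h, 0 <= w -> 0 <= h ->
  x1 <= x -> x + w <= x2 -> y1 <= y -> y + h <= y2 ->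
  Cmod (rect_int g x (x + w) y (y + h)) <= eps * (w + h) ^ 2).
{ intros eps. apply (rectangle_bisection (fun x y w h =>
    x1 <= x -> x + w <= x2 -> y1 <= y -> y + h <= y2 ->
    Cmod (rect_int g x (x + w) y (y + h)) <= eps * (w + h) ^ 2)).
  - intros x y w h Hw Hh Q1 Q2 Q3 Q4 A1 A2 A3 A4.
    specialize (Q1 ltac:(lra) ltac:(lra) ltac:(lra) ltac:(lra)).
    specialize (Q2 ltac:(lra) ltac:(lra) ltac:(lra) ltac:(lra)).
    specialize (Q3 ltac:(lra) ltac:(lra) ltac:(lra) ltac:(lra)).
    specialize (Q4 ltac:(lra) ltac:(lra) ltac:(lra) ltac:(lra)).
    replace (x + w / 2 + w / 2) with (x + w) in * by field.
    replace (y + h / 2 + h / 2) with (y + h) in * by field.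
    rewrite (rect_int_split g x (x + w / 2) (x + w) y (y + h / 2) (y + h)); try lra;
      [ | now apply Cg ].
    eapply Rle_trans; [ apply Cmod_triangle | ].
    eapply Rle_trans; [ apply Rplus_le_compat_r, Cmod_triangle | ].
    eapply Rle_trans; [ apply Rplus_le_compat_r, Rplus_le_compat_r, Cmod_triangle | ].
    replace (eps * (w + h) ^ 2) with (4 * (eps * (w / 2 + h / 2) ^ 2)) by field. lra.
  - intros a b.
    destruct (classic (in_rect x1 x2 y1 y2 (a, b))) as [Hab|Hab].
    + destruct (proj1 (hol_iff g (a, b)) (Hg _ Hab)) as [q [Hq Hl]].
      apply locally_Cmod in Hl. destruct Hl as [d1 Hl].
      destruct (proj1 (continuous_Cmod q _) Hq (pos_div_2 eps)) as [d2 Hd2].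
      assert (Hd : 0 < Rmin d1 d2 / 2).
      { generalize (Rmin_pos d1 d2 (cond_pos d1) (cond_pos d2)); lra. }
      exists (mkposreal _ Hd); simpl. intros x y w h Hxa Hyb Hw Hh A1 A2 A3 A4.
      pose (al := (g (a, b) - q (a, b) * (a, b))%C).
      assert (Near : forall z, in_rect x (x + w) y (y + h) z ->
        Cmod (z - (a, b))%C <= w + h).
      { intros [u v] [B1 B2]. simpl in B1, B2.
        change (Cmod (u + - a, v + - b) <= w + h).
        apply Rle_trans with (1 := Cmod_le_l1 _ _).
        apply Rplus_le_compat; apply Rabs_le; lra. }
      assert (Crem : ccont_rect (fun z => g z - (al + z * q (a, b)))%C x (x + w) y (y + h)).
      { intros z Hz. apply ccont_minus; [ now apply (Cg x y w h) | ].
        apply ccont_plus; [ apply ccont_const | ].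
        apply ccont_mult; [ apply continuous_id | apply ccont_const ]. }
      rewrite (rect_int_ext g (fun z => (g z - (al + z * q (a, b))) + (al + z * q (a, b)))%C)
        by (try lra; intros; ring).
      rewrite rect_int_plus; try lra; [ | exact Crem | ].
      2:{ intros z _. apply ccont_plus; [ apply ccont_const | ].
        apply ccont_mult; [ apply continuous_id | apply ccont_const ]. }
      rewrite rect_int_affine, Cplus_0_r by lra.
      apply Rle_trans with (2 * ((x + w - x) + (y + h - y)) * (eps / 2 * (w + h)));
        [ | right; simpl; field ].
      apply Cmod_rect_int_le; try lra; [ exact Crem | ].
      intros z Hz. assert (N := Near z Hz).
      assert (N1 : Cmod (z - (a, b))%C < d1)
        by (apply Rle_lt_trans with (1 := N); generalize (Rmin_l d1 d2); lra).
      assert (N2 : Cmod (z - (a, b))%C < d2)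
        by (apply Rle_lt_trans with (1 := N); generalize (Rmin_r d1 d2); lra).
      rewrite (Hl z N1). unfold al.
      match goal with |- Cmod ?t <= _ =>
        replace t with ((q z - q (a, b)) * (z - (a, b)))%C by ring end.
      rewrite Cmod_mult. apply Rmult_le_compat; try apply Cmod_ge_0; [ | exact N ].
      left; now apply Hd2.
    + exists (mkposreal 1 Rlt_0_1). intros x y w h Hxa Hyb _ _ A1 A2 A3 A4.
      exfalso; apply Hab; split; simpl; lra. }
apply Cmod_eq_0. apply Rle_antisym; [ | apply Cmod_ge_0 ].
apply le_epsilon; intros e He.
set (L := (x2 - x1) + (y2 - y1)).
assert (HL : 0 <= L) by (unfold L; lra).
assert (He' : 0 < e / (L ^ 2 + 1)).
{ apply Rdiv_lt_0_compat; [ easy | generalize (pow2_ge_0 L); lra ]. }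
specialize (Main (mkposreal _ He') x1 y1 (x2 - x1) (y2 - y1)).
replace (x1 + (x2 - x1)) with x2 in Main by ring.
replace (y1 + (y2 - y1)) with y2 in Main by ring.
eapply Rle_trans; [ apply Main; lra | ]. fold L. cbn [pos].
rewrite Rplus_0_l. generalize (pow2_ge_0 L); intros.
replace (e / (L ^ 2 + 1) * L ^ 2) with (e * (L ^ 2 / (L ^ 2 + 1))) by (field; lra).
generalize dependent (L ^ 2); intros M _ _ HM.
assert (HM1 : M / (M + 1) <= 1) by (apply Rle_div_l; lra).
apply Rle_trans with (e * 1); [ apply Rmult_le_compat_l; lra | lra ].
Qed.

(** * Integrals over concentric circles *)

Definition circ_int (f : C -> C) (r : R) : C :=
  CInt (fun t => f (RtoC r * cis t)%C) 0 (2 * PI).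

Lemma Cmod_circ (r t : R) : 0 <= r -> Cmod (RtoC r * cis t)%C = r.
Proof. intros H. rewrite Cmod_mult, Cmod_cis, Cmod_R, Rabs_pos_eq by easy. ring. Qed.

Lemma exp_le_mono (x y : R) : x <= y -> exp x <= exp y.
Proof. intros [H| ->]; [ left; now apply exp_increasing | lra ]. Qed.

(** Goursat's theorem for [f] composed with the exponential: the two
    horizontal sides of the rectangle cancel by periodicity. *)
Lemma circ_int_annulus (f : C -> C) (r1 r2 : R) : 0 < r1 <= r2 ->
  (forall z, r1 <= Cmod z <= r2 -> hol f z) -> circ_int f r1 = circ_int f r2.
Proof.
intros Hr Hf.
assert (HPI := PI_RGT_0).
assert (L : ln r1 <= ln r2).
{ destruct (Rle_lt_or_eq_dec r1 r2) as [Hlt|Heq]; try lra.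
  - left; apply ln_increasing; lra.
  - rewrite Heq; lra. }
assert (G := Goursat (fun z => f (Cexp z)) (ln r1) (ln r2) 0 (2 * PI) L ltac:(lra)).
unfold rect_int, Cexp in G; simpl in G.
rewrite !exp_ln in G by lra.
assert (P : CInt (fun u => f (RtoC (exp u) * cis (2 * PI))%C) (ln r1) (ln r2)
          = CInt (fun u => f (RtoC (exp u) * cis 0)%C) (ln r1) (ln r2)).
{ apply CInt_ext; trivial; intros t _. rewrite <- (Rplus_0_l (2 * PI)).
  now rewrite cis_period. }
rewrite P in G.
fold (circ_int f r1) in G. fold (circ_int f r2) in G.
assert (E : (Ci * (circ_int f r2 - circ_int f r1) = 0)%C).
{ rewrite <- G.
  - ring.
  - intros z [Hz1 _].
    apply (hol_comp f Cexp); [ | apply hol_Cexp ].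
    apply Hf. rewrite Cmod_Cexp. rewrite <- (exp_ln r1), <- (exp_ln r2) by lra.
    split; apply exp_le_mono; tauto. }
assert (I2 := Ci_sqr).
replace (circ_int f r2) with (circ_int f r1 - Ci * (Ci * (circ_int f r2 - circ_int f r1)))%C
  by ring [I2].
rewrite E. ring.
Qed.

(** * Cauchy and Poisson formulas *)

Definition holo_disc (R0 : R) (f : C -> C) : Prop := forall z, Cmod z < R0 -> hol f z.

Lemma Cmod_real_circ (r t : R) : Cmod (RtoC r * cis t)%C = Rabs r.
Proof. rewrite Cmod_mult, Cmod_cis, Cmod_R. ring. Qed.

Lemma cont_Rabs_lt (r0 R0 : R) : Rabs r0 < R0 -> locally r0 (fun r => Rabs r < R0).
Proof.
intros H. apply (cont_Rcomp Rabs (fun r => r) r0 (continuous_Rabs r0) (continuous_id r0)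
  (fun x => x < R0)). now apply open_lt.
Qed.

Lemma ccont_circle {U : UniformSpace} (f : C -> C) (h k : U -> R) (x : U) :
  Ccont f (RtoC (h x) * cis (k x))%C -> continuous h x -> continuous k x ->
  ccont (fun u => f (RtoC (h u) * cis (k u))%C) x.
Proof.
intros Hf Hh Hk. apply ccont_comp; [ exact Hf | ].
apply ccont_mult; [ now apply ccont_RtoC | now apply ccont_cis ].
Qed.

Lemma ccont_on_circle (f : C -> C) (r a b : R) :
  (forall t, Ccont f (RtoC r * cis t)%C) -> ccont_on (fun t => f (RtoC r * cis t)%C) a b.
Proof.
intros H t _. apply (ccont_circle f (fun _ => r) (fun t => t)); [ apply H | | ].
- apply continuous_const.
- apply continuous_id.
Qed.

Lemma circ_int_cont (f : C -> C) (R0 r0 : R) :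
  (forall z, Cmod z < R0 -> Ccont f z) -> Rabs r0 < R0 -> ccont (circ_int f) r0.
Proof.
intros Hf Hr. apply (ccont_CInt_param (fun r t => f (RtoC r * cis t)%C)).
- generalize PI_RGT_0; lra.
- intros t _. apply (ccont_circle f (fun p : R * R => fst p) (fun p : R * R => snd p)).
  + apply Hf. now rewrite Cmod_real_circ.
  + apply continuous_fst.
  + apply continuous_snd.
- generalize (cont_Rabs_lt r0 R0 Hr); apply filter_imp; intros r Hr'.
  apply ccont_on_circle; intros t. apply Hf. now rewrite Cmod_real_circ.
Qed.

Lemma cont_frequently_eq (m : R -> C) (a : R) (v : C) : ccont m a ->
  (forall d, 0 < d -> exists s, Rabs (s - a) < d /\ m s = v) -> m a = v.
Proof.
intros Hm Hs.
destruct (Ceq_dec (m a) v) as [|N]; [ easy | exfalso ].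
assert (P : 0 < Cmod (m a - v)).
{ apply Cmod_gt_0. intros E; apply N. replace (m a) with (m a - v + v)%C by ring.
  rewrite E; ring. }
assert (Hl : locally (m a) (fun z : C => Cmod (z - m a) < Cmod (m a - v))).
{ apply locally_Cmod. now exists (mkposreal _ P). }
destruct (Hm _ Hl) as [d Hd].
destruct (Hs d (cond_pos d)) as [s [H1 H2]].
specialize (Hd s H1). cbv beta in Hd. rewrite H2 in Hd.
replace (v - m a)%C with (- (m a - v))%C in Hd by ring.
rewrite Cmod_opp in Hd. lra.
Qed.

(** One exceptional point at which [f] is merely continuous does no harm: the
    mean over circles is locally constant away from its modulus and
    continuous across it. *)
Lemma circ_int_mean (f : C -> C) (R0 : R) (w : C) (r : R) :
  (forall z, Cmod z < R0 -> Ccont f z) ->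
  (forall z, Cmod z < R0 -> z <> w -> hol f z) ->
  0 <= r < R0 -> circ_int f r = (RtoC (2 * PI) * f 0)%C.
Proof.
intros Hc Hh Hr. set (k := Cmod w).
assert (HPI := PI_RGT_0).
assert (Hk : 0 <= k) by apply Cmod_ge_0.
assert (Cm : forall s, 0 <= s < R0 -> ccont (circ_int f) s).
{ intros s Hs. apply circ_int_cont with (1 := Hc). rewrite Rabs_pos_eq; lra. }
assert (Cst : forall r1 r2, 0 < r1 <= r2 -> r2 < R0 -> k < r1 \/ r2 < k ->
  circ_int f r1 = circ_int f r2).
{ intros r1 r2 H1 H2 H3. apply circ_int_annulus; [ easy | ].
  intros z Hz. apply Hh; [ lra | ]. intros ->. fold k in Hz. lra. }
assert (E0 : circ_int f 0 = (RtoC (2 * PI) * f 0)%C).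
{ unfold circ_int. rewrite (CInt_ext 0 (2 * PI) ltac:(lra) _ (fun _ => f 0%C)).
  - rewrite CInt_const by lra. now rewrite Rminus_0_r.
  - intros t _. f_equal. ring. }
rewrite <- E0. clear E0.
assert (Below : forall s, 0 < s < R0 -> s < k -> circ_int f s = circ_int f 0).
{ intros s Hs Hsk. symmetry. apply cont_frequently_eq; [ apply Cm; lra | ].
  intros d Hd. exists (Rmin (d / 2) s).
  assert (0 < Rmin (d / 2) s) by (apply Rmin_pos; lra).
  generalize (Rmin_l (d / 2) s) (Rmin_r (d / 2) s); intros A1 A2. split.
  - rewrite Rabs_pos_eq; lra.
  - apply Cst; lra. }
assert (At : k < R0 -> circ_int f k = circ_int f 0).
{ intros Hk'. destruct (Req_dec k 0) as [->|Nk]; [ easy | ].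
  apply cont_frequently_eq; [ apply Cm; lra | ].
  intros d Hd. exists (Rmax (k - d / 2) (k / 2)).
  generalize (Rmax_l (k - d / 2) (k / 2)) (Rmax_r (k - d / 2) (k / 2)); intros A1 A2.
  assert (A3 : Rmax (k - d / 2) (k / 2) < k) by (apply Rmax_lub_lt; lra). split.
  - rewrite Rabs_left; lra.
  - apply Below; lra. }
destruct (Rtotal_order r k) as [L|[->|G]].
- destruct (Req_dec r 0) as [->|Nr]; [ easy | apply Below; lra ].
- apply At; lra.
- rewrite <- At by lra. symmetry. apply cont_frequently_eq; [ apply Cm; lra | ].
  intros d Hd. exists (Rmin (k + d / 2) r).
  generalize (Rmin_l (k + d / 2) r) (Rmin_r (k + d / 2) r); intros A1 A2.
  assert (A3 : k < Rmin (k + d / 2) r) by (apply Rmin_glb_lt; lra). split.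
  + rewrite Rabs_pos_eq; lra.
  + apply Cst; lra.
Qed.

Lemma Cminus_neq0 (z w : C) : z <> w -> (z - w)%C <> 0%C.
Proof.
intros n E; apply n. replace z with (z - w + w)%C by ring. rewrite E; ring.
Qed.

Lemma locally_neq (z w : C) : z <> w -> locally (T := C_UniformSpace) z (fun u => u <> w).
Proof.
intros n. assert (P := Cminus_neq0 z w n).
generalize (ccont_neq0 (fun u => u - w)%C z
  (ccont_minus (U := C_UniformSpace) (fun u => u) (fun _ => w) z
    (continuous_id z) (ccont_const w z)) P).
apply filter_imp; intros u Hu ->. apply Hu. ring.
Qed.

(** The difference quotient at [w] is holomorphic off [w] and so far only
    continuous at [w]. *)
Lemma hol_slope (f : C -> C) (w : C) : hol f w ->
  exists D : C -> C, Ccont D w /\ (forall z, f z = (f w + D z * (z - w))%C) /\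
    forall z, z <> w -> hol f z -> hol D z.
Proof.
intros H. apply hol_iff in H. destruct H as [q [Hq Hf]].
pose (D := fun z => if excluded_middle_informative (z = w) then q w
                    else ((f z - f w) / (z - w))%C).
assert (Dn : forall z, z <> w -> D z = ((f z - f w) / (z - w))%C).
{ intros z n. unfold D. now destruct (excluded_middle_informative (z = w)). }
exists D; split; [ | split ].
- apply (continuous_ext_loc _ q); [ | exact Hq ].
  revert Hf; apply filter_imp; intros z E; change C in z.
  unfold D; destruct (excluded_middle_informative (z = w)) as [->|n]; [ easy | ].
  rewrite E; change C in z. assert (P := Cminus_neq0 z w n).
  match goal with |- @eq _ ?a ?b => change (@eq C a b) end. now field.
- intros z. destruct (excluded_middle_informative (z = w)) as [->|n]; [ ring | ].
  rewrite Dn by easy. assert (P := Cminus_neq0 z w n). now field.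
- intros z n Hz. apply (hol_ext_loc (fun u => (f u - f w) / (u - w))%C).
  + generalize (locally_neq z w n); apply filter_imp; intros u Hu. now rewrite Dn.
  + apply hol_div; [ now apply Cminus_neq0 | | ].
    * apply hol_minus; [ exact Hz | apply hol_const ].
    * apply hol_minus; [ apply hol_id | apply hol_const ].
Qed.

Lemma CInt_conj (f : R -> C) (a b : R) : a <= b -> ccont_on f a b ->
  CInt (fun t => Cconj (f t)) a b = Cconj (CInt f a b).
Proof.
intros Hab Hf. apply injective_projections; simpl.
- reflexivity.
- exact (RInt_opp (fun t => Im (f t)) a b (ex_RInt_Im a b Hab f Hf)).
Qed.

Lemma kernel_neq0 (r : R) (w z : C) : Cmod z * Cmod w < r * r ->
  (RtoC (r * r) - Cconj w * z)%C <> 0%C.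
Proof.
intros H E.
assert (E' : (RtoC (r * r) = Cconj w * z)%C).
{ replace (RtoC (r * r)) with (RtoC (r * r) - Cconj w * z + Cconj w * z)%C by ring.
  rewrite E; ring. }
apply (f_equal Cmod) in E'. rewrite Cmod_mult, Cmod_conj, Cmod_R in E'.
rewrite Rabs_pos_eq in E' by apply Rle_0_sqr. lra.
Qed.

Lemma hol_kernel (c : C) (r : R) (w z : C) : Cmod z * Cmod w < r * r ->
  hol (fun z => c / (RtoC (r * r) - Cconj w * z))%C z.
Proof.
intros H. apply hol_div; [ now apply kernel_neq0 | apply hol_const | ].
apply hol_minus; [ apply hol_const | ].
apply hol_mult; [ apply hol_const | apply hol_id ].
Qed.

(** The radius up to which the kernel with pole at the reflection of [w] is
    holomorphic exceeds [r]. *)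
Lemma kernel_radius (r : R) (w : C) : Cmod w < r ->
  exists R1, r < R1 /\ forall z, Cmod z < R1 -> Cmod z * Cmod w < r * r.
Proof.
intros H. assert (P := Cmod_ge_0 w). set (k := Cmod w) in *.
(* A value strictly above r that is at most r ^ 2 / |w|. *)
exists (2 * (r * r) / (r + k)); split.
- apply Rlt_div_r; nra.
- intros z Hz. assert (Q := Cmod_ge_0 z).
  apply Rlt_div_r in Hz; [ | lra ]. nra.
Qed.

Lemma circle_conj (r t : R) :
  (Cconj (RtoC r * cis t) * (RtoC r * cis t) = RtoC (r * r))%C.
Proof.
rewrite Cmult_conj, Cconj_cis.
rewrite Cconj_RtoC.
transitivity (RtoC r * RtoC r * (cis (- t) * cis t))%C; [ ring | ].
rewrite cis_opp_l, RtoC_mult; ring.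
Qed.

Lemma circle_neq (r t : R) (w : C) : Cmod w < r -> (RtoC r * cis t)%C <> w.
Proof.
intros H <-. rewrite Cmod_circ in H; [ lra | ].
generalize (Cmod_ge_0 (RtoC r * cis t)%C); lra.
Qed.

(** On the circle the Cauchy kernel is the conjugate of a function holomorphic
    in a larger disc, to which the mean value property applies. *)
Lemma cauchy_kernel_int (r : R) (w : C) : Cmod w < r ->
  circ_int (fun z => z / (z - w))%C r = RtoC (2 * PI).
Proof.
intros H. assert (P := Cmod_ge_0 w). assert (HPI := PI_RGT_0).
destruct (kernel_radius r w H) as [R1 [HR1 HR2]].
pose (k := fun z => (RtoC (r * r) / (RtoC (r * r) - Cconj w * z))%C).
assert (Hk : forall z, Cmod z < R1 -> hol k z) by (intros; now apply hol_kernel, HR2).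
assert (M : circ_int k r = (RtoC (2 * PI) * k 0)%C).
{ apply circ_int_mean with R1 (RtoC 0); auto; [ | lra ].
  intros z Hz. now apply hol_cont, Hk. }
assert (N0 : RtoC (r * r) <> 0%C).
{ intros E; apply (f_equal Re) in E; simpl in E. nra. }
transitivity (Cconj (circ_int k r)).
- unfold circ_int. rewrite <- CInt_conj; [ | lra | ].
  + apply CInt_ext; [ lra | ]. intros t _. unfold k.
    assert (E := circle_conj r t). assert (N := circle_neq r t w H).
    set (z := (RtoC r * cis t)%C) in *.
    assert (Nz : Cmod z = r) by (apply Cmod_circ; lra).
    assert (N1 : (RtoC (r * r) - Cconj w * z)%C <> 0%C).
    { apply kernel_neq0. rewrite Nz. nra. }
    assert (Nz0 : Cconj z <> 0%C).
    { intros F. apply N0. rewrite <- E, F. ring. }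
    rewrite Cdiv_conj by exact N1. rewrite Cminus_conj, Cmult_conj, Cconj_conj.
    rewrite Cconj_RtoC.
    rewrite <- E. assert (N2 := Cminus_neq0 z w N).
    replace (Cconj z * z - w * Cconj z)%C with (Cconj z * (z - w))%C by ring.
    now field.
  + apply ccont_on_circle. intros t. apply hol_cont, Hk. rewrite Cmod_circ; lra.
- rewrite M. unfold k. replace (RtoC (r * r) - Cconj w * 0)%C with (RtoC (r * r)) by ring.
  unfold Cdiv. rewrite Cinv_r by exact N0.
  apply injective_projections; simpl; ring.
Qed.

(** The difference quotient of [f] at [w], multiplied by [z] to absorb the
    Jacobian of the circle, has mean 0 although it may fail to be
    differentiable at [w]. *)
Lemma cauchy_formula (f : C -> C) (R0 r : R) (w : C) :
  holo_disc R0 f -> Cmod w < r < R0 ->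
  circ_int (fun z => z * f z / (z - w))%C r = (RtoC (2 * PI) * f w)%C.
Proof.
intros Hf Hr. assert (HPI := PI_RGT_0). assert (P := Cmod_ge_0 w).
destruct (hol_slope f w) as [D [CD [ED HD]]].
{ apply Hf; lra. }
pose (h := fun z => (z * D z)%C).
assert (Hh : forall z, Cmod z < R0 -> z <> w -> hol h z).
{ intros z Hz n. apply hol_mult; [ apply hol_id | apply HD; auto ]. }
assert (Ch : forall z, Cmod z < R0 -> Ccont h z).
{ intros z Hz. destruct (Ceq_dec z w) as [->|n].
  - apply ccont_mult; [ apply continuous_id | exact CD ].
  - now apply hol_cont, Hh. }
assert (M := circ_int_mean h R0 w r Ch Hh ltac:(lra)).
unfold h in M at 2. rewrite Cmult_0_l, Cmult_0_r in M.
assert (K := cauchy_kernel_int r w ltac:(lra)).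
assert (Ck : forall t, Ccont (fun z => z / (z - w))%C (RtoC r * cis t)%C).
{ intros t. apply ccont_div; [ | apply continuous_id | ].
  - apply Cminus_neq0, circle_neq; lra.
  - apply ccont_minus; [ apply continuous_id | apply ccont_const ]. }
transitivity (circ_int h r + f w * circ_int (fun z => z / (z - w))%C r)%C.
- unfold circ_int. rewrite <- CInt_scal; [ | lra | ].
  + rewrite <- CInt_plus; [ | lra | | ].
    * apply CInt_ext; [ lra | ]. intros t _.
      assert (N := Cminus_neq0 _ _ (circle_neq r t w ltac:(lra))).
      set (z := (RtoC r * cis t)%C) in *. unfold h.
      rewrite (ED z) at 1. now field.
    * apply ccont_on_circle. intros t. apply Ch. rewrite Cmod_circ; lra.
    * intros t Ht. apply ccont_mult; [ apply ccont_const | ].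
      now apply (ccont_on_circle (fun z => z / (z - w))%C r 0 (2 * PI)).
  + now apply (ccont_on_circle (fun z => z / (z - w))%C r).
- rewrite M, K. ring.
Qed.

(** A Cauchy transform is holomorphic inside the circle: its difference
    quotients are again Cauchy transforms, and depend continuously on the
    point. *)
Lemma hol_cauchy_transform (phi : R -> C) (r : R) (w : C) :
  (forall t, ccont phi t) -> Cmod w < r ->
  hol (fun u => CInt (fun t => phi t / (RtoC r * cis t - u))%C 0 (2 * PI)) w.
Proof.
intros Hphi Hr. assert (HPI := PI_RGT_0). assert (P := Cmod_ge_0 w).
assert (Hn : locally (T := C_UniformSpace) w (fun u => Cmod u < r)).
{ apply (cont_Cmod (U := C_UniformSpace) (fun u => u) w (continuous_id w) (fun x => x < r)).
  now apply open_lt. }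
assert (Cz : forall t, ccont (fun t => RtoC r * cis t)%C t).
{ intros t. apply ccont_mult; [ apply ccont_const | apply ccont_cis, continuous_id ]. }
assert (C1 : forall u, Cmod u < r ->
  ccont_on (fun t => phi t / (RtoC r * cis t - u))%C 0 (2 * PI)).
{ intros u Hu t _. apply ccont_div; [ | apply Hphi | ].
  - now apply Cminus_neq0, circle_neq.
  - apply ccont_minus; [ apply Cz | apply ccont_const ]. }
assert (C2 : forall u, Cmod u < r ->
  ccont_on (fun t => phi t / ((RtoC r * cis t - w) * (RtoC r * cis t - u)))%C 0 (2 * PI)).
{ intros u Hu t _. apply ccont_div; [ | apply Hphi | ].
  - apply Cmult_neq_0; now apply Cminus_neq0, circle_neq.
  - apply ccont_mult; (apply ccont_minus; [ apply Cz | apply ccont_const ]). }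
apply hol_iff.
exists (fun u => CInt (fun t => phi t / ((RtoC r * cis t - w) * (RtoC r * cis t - u)))%C 0 (2 * PI)).
split.
- apply (ccont_CInt_param (U := C_UniformSpace)
    (fun u t => phi t / ((RtoC r * cis t - w) * (RtoC r * cis t - u)))%C).
  + lra.
  + intros t _.
    assert (Cs : ccont (fun p : C_UniformSpace * R => RtoC r * cis (snd p))%C (w, t)).
    { apply ccont_mult; [ apply ccont_const | apply ccont_cis, continuous_snd ]. }
    apply ccont_div.
    * simpl. apply Cmult_neq_0; now apply Cminus_neq0, circle_neq.
    * apply (continuous_comp (V := R_UniformSpace) (fun p : C_UniformSpace * R => snd p) phi).
      { apply continuous_snd. }
      { apply Hphi. }
    * apply ccont_mult; (apply ccont_minus; [ exact Cs | ]);
        [ apply ccont_const | apply continuous_fst ].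
  + revert Hn; apply filter_imp; intros u Hu. now apply C2.
- revert Hn; apply filter_imp; intros u Hu; change C in u.
  rewrite Cmult_comm, <- CInt_scal; [ | lra | now apply C2 ].
  rewrite <- CInt_plus; [ | lra | now apply C1 | ].
  + apply CInt_ext; [ lra | ]; intros t _.
    assert (N1 := Cminus_neq0 _ _ (circle_neq r t w Hr)).
    assert (N2 := Cminus_neq0 _ _ (circle_neq r t u Hu)).
    now field.
  + intros t Ht. apply ccont_mult; [ apply ccont_const | now apply C2 ].
Qed.

(** By the Cauchy formula the quotient is, near the zero [w], the Cauchy
    transform of [z * f z / (z - w)]. *)
Lemma hol_divide_root (f : C -> C) (R0 : R) (w : C) :
  holo_disc R0 f -> Cmod w < R0 -> f w = 0%C ->
  exists q, holo_disc R0 q /\ forall z, Cmod z < R0 -> f z = ((z - w) * q z)%C.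
Proof.
intros Hf Hw H0. assert (P := Cmod_ge_0 w). assert (HPI := PI_RGT_0).
set (r := (Cmod w + R0) / 2). assert (Hr : Cmod w < r < R0) by (unfold r; lra).
pose (phi := fun t => (RtoC r * cis t * f (RtoC r * cis t) / (RtoC r * cis t - w))%C).
assert (Cphi : forall t, ccont phi t).
{ intros t. apply ccont_div.
  - apply Cminus_neq0, circle_neq; lra.
  - apply ccont_mult.
    + apply ccont_mult; [ apply ccont_const | apply ccont_cis, continuous_id ].
    + apply (ccont_circle f (fun _ => r) (fun t => t)).
      * apply hol_cont, Hf. rewrite Cmod_circ; lra.
      * apply continuous_const.
      * apply continuous_id.
  - apply ccont_minus; [ | apply ccont_const ].
    apply ccont_mult; [ apply ccont_const | apply ccont_cis, continuous_id ]. }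
pose (Q := fun u => (/ RtoC (2 * PI) *
  CInt (fun t => phi t / (RtoC r * cis t - u)) 0 (2 * PI))%C).
assert (NPI : RtoC (2 * PI) <> 0%C).
{ intros E; apply (f_equal Re) in E; simpl in E; lra. }
(* Subtract from the Cauchy formula at u the one at w, whose value is 0. *)
assert (EQ : forall u, Cmod u < r -> f u = ((u - w) * Q u)%C).
{ intros u Hu.
  assert (A := cauchy_formula f R0 r u Hf ltac:(lra)).
  assert (B := cauchy_formula f R0 r w Hf ltac:(lra)). rewrite H0, Cmult_0_r in B.
  apply (f_equal (fun x => / RtoC (2 * PI) * x)%C) in A.
  rewrite Cmult_assoc, Cinv_l, Cmult_1_l in A by exact NPI.
  rewrite <- A. unfold Q.
  match goal with |- (_ * ?x)%C = _ => replace x with (x - 0)%C by ring end.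
  rewrite <- B. unfold circ_int.
  assert (Cf : forall v, Cmod v < r ->
    ccont_on (fun t => RtoC r * cis t * f (RtoC r * cis t) / (RtoC r * cis t - v))%C 0 (2 * PI)).
  { intros v Hv. apply (ccont_on_circle (fun z => z * f z / (z - v))%C). intros t.
    apply ccont_div.
    - now apply Cminus_neq0, circle_neq.
    - apply ccont_mult; [ apply continuous_id | ].
      apply hol_cont, Hf. rewrite Cmod_circ; lra.
    - apply ccont_minus; [ apply continuous_id | apply ccont_const ]. }
  rewrite <- CInt_minus; [ | lra | now apply Cf | apply Cf; lra ].
  transitivity (/ RtoC (2 * PI) * ((u - w) * CInt (fun t => phi t / (RtoC r * cis t - u)) 0 (2 * PI)))%C;
    [ | ring ].
  f_equal. rewrite <- CInt_scal; [ | lra | ].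
  - apply CInt_ext; [ lra | ]; intros t _. unfold phi.
    assert (N1 := Cminus_neq0 _ _ (circle_neq r t w ltac:(lra))).
    assert (N2 := Cminus_neq0 _ _ (circle_neq r t u Hu)).
    field; auto.
  - intros t _. apply ccont_div; [ | apply Cphi | ].
    + now apply Cminus_neq0, circle_neq.
    + apply ccont_minus; [ | apply ccont_const ].
      apply ccont_mult; [ apply ccont_const | apply ccont_cis, continuous_id ]. }
pose (q := fun z => if Rlt_dec (Cmod z) r then Q z else (f z / (z - w))%C).
exists q; split.
- intros z Hz. destruct (Ceq_dec z w) as [->|n].
  + apply (hol_ext_loc Q).
    * assert (L : locally (T := C_UniformSpace) w (fun u => Cmod u < r)).
      { apply (cont_Cmod (U := C_UniformSpace) (fun u => u) w (continuous_id w) (fun x => x < r)).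
        now apply open_lt. }
      revert L; apply filter_imp; intros u Hu. unfold q. now destruct (Rlt_dec (Cmod u) r).
    * apply hol_mult; [ apply hol_const | now apply hol_cauchy_transform ].
  + apply (hol_ext_loc (fun u => f u / (u - w))%C).
    * generalize (locally_neq z w n); apply filter_imp; intros u Hu; change C in u.
      unfold q. destruct (Rlt_dec (Cmod u) r) as [L|L]; [ | easy ].
      rewrite (EQ u L). assert (N := Cminus_neq0 u w Hu).
      match goal with |- @eq _ ?a ?b => change (@eq C a b) end. now field.
    * apply hol_div; [ now apply Cminus_neq0 | now apply Hf | ].
      apply hol_minus; [ apply hol_id | apply hol_const ].
- intros z Hz. unfold q. destruct (Rlt_dec (Cmod z) r) as [L|L]; [ now apply EQ | ].
  assert (N : (z - w)%C <> 0%C) by (apply Cminus_neq0; intros ->; lra).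
  now field.
Qed.

(** The Poisson kernel of the disc of radius [r] at its point [w]. *)
Definition poisson (r : R) (w : C) (t : R) : R :=
  (r * r - Cmod w ^ 2) / Cmod (RtoC r * cis t - w) ^ 2.

Lemma poisson_pos (r : R) (w : C) (t : R) : Cmod w < r -> 0 < poisson r w t.
Proof.
intros H. assert (P := Cmod_ge_0 w). apply Rdiv_lt_0_compat; [ nra | ].
apply pow_lt, Cmod_gt_0, Cminus_neq0. now apply circle_neq.
Qed.

Lemma poisson_cont (r : R) (w : C) (t : R) : Cmod w < r -> continuous (poisson r w) t.
Proof.
intros H. apply cont_Rmult; [ apply continuous_const | ]. apply cont_Rinv.
- apply pow_nonzero. intros E. apply Cmod_eq_0 in E.
  revert E. now apply Cminus_neq0, circle_neq.
- apply cont_pow, cont_Cmod, ccont_minus; [ | apply ccont_const ].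
  apply ccont_mult; [ apply ccont_const | apply ccont_cis, continuous_id ].
Qed.

(** The Cauchy formula for [f] times a kernel that equals 1 at [w] and turns
    the Cauchy kernel into a positive one. *)
Lemma poisson_formula (f : C -> C) (R0 r : R) (w : C) :
  holo_disc R0 f -> Cmod w < r < R0 ->
  CInt (fun t => RtoC (poisson r w t) * f (RtoC r * cis t))%C 0 (2 * PI)
  = (RtoC (2 * PI) * f w)%C.
Proof.
intros Hf Hr. assert (P := Cmod_ge_0 w). assert (HPI := PI_RGT_0).
destruct (kernel_radius r w ltac:(lra)) as [R1 [HR1 HR2]].
pose (c := RtoC (r * r - Cmod w ^ 2)).
pose (k := fun z => (c / (RtoC (r * r) - Cconj w * z))%C).
assert (Ekw : k w = 1%C).
{ unfold k, c. rewrite RtoC_minus, Cmod2_conj, (Cmult_comm w).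
  unfold Cdiv. apply Cinv_r. apply kernel_neq0. nra. }
rewrite <- (Cmult_1_r (f w)), <- Ekw.
rewrite <- (cauchy_formula (fun z => f z * k z)%C (Rmin R0 R1) r w).
- unfold circ_int. apply CInt_ext; [ lra | ]. intros t _. unfold k, poisson.
  assert (E := circle_conj r t). assert (N := circle_neq r t w ltac:(lra)).
  set (z := (RtoC r * cis t)%C) in *.
  assert (Nz : Cmod z = r) by (apply Cmod_circ; lra).
  assert (N2 := Cminus_neq0 z w N).
  assert (Nz0 : z <> 0%C) by (intros F; rewrite F, Cmod_0 in Nz; lra).
  assert (N3 : (Cconj z - Cconj w)%C <> 0%C).
  { rewrite <- Cminus_conj. intros F. apply N2.
    rewrite <- (Cconj_conj (z - w)), F. apply injective_projections; simpl; ring. }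
  rewrite RtoC_div by (apply pow_nonzero; intros F; now apply N2, Cmod_eq_0).
  rewrite Cmod2_conj, Cminus_conj. fold c.
  replace (RtoC (r * r) - Cconj w * z)%C with (z * (Cconj z - Cconj w))%C by (rewrite <- E; ring).
  field; auto.
- intros z Hz. apply hol_mult.
  + apply Hf. apply Rlt_le_trans with (1 := Hz), Rmin_l.
  + apply hol_kernel, HR2. apply Rlt_le_trans with (1 := Hz), Rmin_r.
- split; [ lra | apply Rmin_glb_lt; lra ].
Qed.

Lemma poisson_mass (r : R) (w : C) : Cmod w < r -> RInt (poisson r w) 0 (2 * PI) = 2 * PI.
Proof.
intros H.
assert (E := poisson_formula (fun _ => RtoC 1) (r + 1) r w
  ltac:(intros z _; apply hol_const) ltac:(lra)).
apply (f_equal Re) in E. unfold CInt in E; simpl in E.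
rewrite (RInt_ext _ (poisson r w)) in E by (intros; simpl; ring).
lra.
Qed.

(** The distance from [s cis a] to [r cis b] is symmetric in [a] and [b]. *)
Lemma poisson_sym (r s a b : R) : 0 <= s ->
  poisson r (RtoC s * cis a) b = poisson r (RtoC s * cis b) a.
Proof.
intros Hs. unfold poisson. rewrite !Cmod_circ by easy. f_equal.
rewrite !Cmod2_alt. unfold cis; simpl.
generalize (sin2_cos2 a) (sin2_cos2 b); unfold Rsqr; intros Ea Eb.
match goal with |- ?x = ?y => cut (x - y = 0); [ lra | ] end.
transitivity ((r * r - s * s) * ((sin b * sin b + cos b * cos b) - (sin a * sin a + cos a * cos a)));
  [ ring | rewrite Ea, Eb; ring ].
Qed.

(** * Powers and integral means *)

Lemma rpow_pos_eq (x p : R) : 0 < x -> rpow x p = Rpower x p.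
Proof. intros H; unfold rpow. destruct (Rle_dec x 0); lra. Qed.

Lemma rpow_npos_eq (x p : R) : x <= 0 -> rpow x p = 0.
Proof. intros H; unfold rpow. destruct (Rle_dec x 0); lra. Qed.

Lemma rpow_gt0 (x p : R) : 0 < x -> 0 < rpow x p.
Proof. intros H; rewrite rpow_pos_eq by easy. apply exp_pos. Qed.

Lemma rpow_ge0 (x p : R) : 0 <= rpow x p.
Proof.
destruct (Rle_dec x 0) as [H|H].
- rewrite rpow_npos_eq; lra.
- left; apply rpow_gt0; lra.
Qed.

Lemma rpow_1_l (p : R) : rpow 1 p = 1.
Proof. rewrite rpow_pos_eq by lra. unfold Rpower. rewrite ln_1, Rmult_0_r. apply exp_0. Qed.

Lemma rpow_mono (x y p : R) : 0 < p -> x <= y -> rpow x p <= rpow y p.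
Proof.
intros Hp H. destruct (Rle_dec x 0) as [Hx|Hx].
- rewrite (rpow_npos_eq x) by easy. apply rpow_ge0.
- rewrite !rpow_pos_eq by lra. apply Rle_Rpower_l; lra.
Qed.

Lemma rpow_mult (x y p : R) : 0 <= x -> 0 <= y -> rpow (x * y) p = rpow x p * rpow y p.
Proof.
intros [Hx|<-] [Hy|<-].
- rewrite !rpow_pos_eq; trivial; [ | now apply Rmult_lt_0_compat ].
  now rewrite Rpower_mult_distr.
- rewrite Rmult_0_r, (rpow_npos_eq 0) by lra. ring.
- rewrite Rmult_0_l, (rpow_npos_eq 0) by lra. ring.
- rewrite Rmult_0_l, (rpow_npos_eq 0) by lra. ring.
Qed.

Lemma rpow_rpow (x p q : R) : 0 <= x -> p * q = 1 -> rpow (rpow x p) q = x.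
Proof.
intros [Hx|<-] H.
- rewrite (rpow_pos_eq (rpow x p)) by now apply rpow_gt0.
  rewrite rpow_pos_eq by easy. rewrite Rpower_mult, H. now apply Rpower_1.
- rewrite (rpow_npos_eq 0) by lra. apply rpow_npos_eq; lra.
Qed.

Lemma rpow_cont (x p : R) : 0 < p -> continuous (fun x => rpow x p) x.
Proof.
intros Hp. destruct (Rtotal_order x 0) as [L|[->|G]].
- apply (continuous_ext_loc _ (fun _ => 0)); [ | apply continuous_const ].
  generalize (open_lt 0 x L); apply filter_imp; intros y Hy. symmetry; apply rpow_npos_eq; lra.
- apply filterlim_locally; intros eps.
  assert (Hd : 0 < rpow eps (/ p)) by apply rpow_gt0, cond_pos.
  exists (mkposreal _ Hd); intros y Hy.
  change (Rabs (y - 0) < rpow eps (/ p)) in Hy.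
  change (Rabs (rpow y p - rpow 0 p) < eps).
  rewrite (rpow_npos_eq 0), !Rminus_0_r in * by lra.
  rewrite Rabs_pos_eq by apply rpow_ge0.
  destruct (Rle_dec y 0) as [H|H].
  + rewrite rpow_npos_eq by easy. apply cond_pos.
  + rewrite Rabs_pos_eq in Hy by lra.
    rewrite <- (rpow_rpow eps (/ p) p) by ((left; apply cond_pos) || (field; lra)).
    rewrite !rpow_pos_eq by lra. apply Rlt_Rpower_l; lra.
- apply (continuous_ext_loc _ (fun y => exp (p * ln y))).
  + generalize (open_gt 0 x G); apply filter_imp; intros y Hy. now rewrite rpow_pos_eq.
  + apply (cont_Rcomp exp (fun y => p * ln y)); [ apply continuous_exp | ].
    apply cont_Rmult; [ apply continuous_const | now apply continuous_ln ].
Qed.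

(** Convexity of [x ^ p]: with [x / y = exp c], this is the tangent inequality
    [1 + u <= exp u] used at [- c] and at [(p - 1) * c]. *)
Lemma rpow_tangent (p y : R) : 1 <= p -> 0 < y ->
  exists K, 0 <= K /\ forall x, 0 <= x -> rpow y p + K * (x - y) <= rpow x p.
Proof.
intros Hp Hy. assert (Py := rpow_gt0 y p Hy).
exists (p * rpow y p / y); split.
{ apply Rdiv_le_0_compat; [ nra | easy ]. }
intros x [Hx|<-].
- set (c := ln (x / y)).
  assert (Ex : x = y * exp c).
  { unfold c; rewrite exp_ln by now apply Rdiv_lt_0_compat. field; lra. }
  assert (Ep : rpow x p = rpow y p * exp (p * c)).
  { rewrite Ex at 1. rewrite rpow_mult by (try (left; apply exp_pos); lra). f_equal.
    rewrite rpow_pos_eq by apply exp_pos. unfold Rpower. now rewrite ln_exp. }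
  rewrite Ep.
  replace (p * rpow y p / y * (x - y)) with (rpow y p * (p * (exp c - 1)))
    by (rewrite Ex; field; lra).
  assert (B : 1 + p * (exp c - 1) <= exp (p * c)).
  { assert (A1 := exp_ineq1_le (- c)). assert (A2 := exp_ineq1_le ((p - 1) * c)).
    assert (Pc := exp_pos c).
    assert (M1 : exp c * (1 + - c) <= 1).
    { apply Rle_trans with (exp c * exp (- c)).
      - apply Rmult_le_compat_l; lra.
      - rewrite <- exp_plus, Rplus_opp_r, exp_0; lra. }
    assert (M2 : exp c * (1 + (p - 1) * c) <= exp (p * c)).
    { apply Rle_trans with (exp c * exp ((p - 1) * c)).
      - apply Rmult_le_compat_l; lra.
      - rewrite <- exp_plus. right; f_equal; ring. }
    nra. }
  nra.
- rewrite (rpow_npos_eq 0) by lra.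
  replace (p * rpow y p / y * (0 - y)) with (- (p * rpow y p)) by (field; lra). nra.
Qed.

(** The integral means before the increasing normalisation
    [x |-> (x / (2 PI)) ^ (1 / p)], which only complicates estimates. *)
Definition pmean (p : R) (f : C -> C) (r : R) : R :=
  RInt (fun t => rpow (Cmod (f (RtoC r * cis t)%C)) p) 0 (2 * PI).

Section Means.
Variable p : R.
Hypothesis Hp : 1 <= p.

Lemma cont_rpow_Cmod {U : UniformSpace} (f : U -> C) (x : U) :
  ccont f x -> continuous (fun u => rpow (Cmod (f u)) p) x.
Proof.
intros H. apply (cont_Rcomp (fun x => rpow x p) (fun u => Cmod (f u))).
- apply rpow_cont; lra.
- now apply cont_Cmod.
Qed.

Lemma pmean_integrand_cont (f : C -> C) (r t : R) :
  (forall s, Ccont f (RtoC r * cis s)%C) ->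
  continuous (fun t => rpow (Cmod (f (RtoC r * cis t)%C)) p) t.
Proof.
intros H. apply (cont_rpow_Cmod (fun t => f (RtoC r * cis t)%C)).
now apply (ccont_on_circle f r t t); [ | lra ].
Qed.

Lemma ex_RInt_pmean (f : C -> C) (r : R) :
  (forall s, Ccont f (RtoC r * cis s)%C) ->
  ex_RInt (fun t => rpow (Cmod (f (RtoC r * cis t)%C)) p) 0 (2 * PI).
Proof.
intros H. apply ex_RInt_cont; intros t _. now apply pmean_integrand_cont.
Qed.

Lemma ccont_holo_circle (f : C -> C) (R0 r s : R) : holo_disc R0 f -> 0 <= r < R0 ->
  Ccont f (RtoC r * cis s)%C.
Proof. intros H Hr. apply hol_cont, H. rewrite Cmod_circ; lra. Qed.

(** The Poisson kernel is a probability density against which [f w] is the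
    mean of [f], so Jensen's inequality applies; it is obtained by integrating
    the tangent inequality. *)
Lemma rpow_le_poisson (f : C -> C) (R0 r : R) (w : C) :
  holo_disc R0 f -> Cmod w < r < R0 ->
  rpow (Cmod (f w)) p * (2 * PI) <=
  RInt (fun t => poisson r w t * rpow (Cmod (f (RtoC r * cis t)%C)) p) 0 (2 * PI).
Proof.
intros Hf Hr. assert (HPI := PI_RGT_0). assert (P := Cmod_ge_0 w).
assert (Cf : forall s, Ccont f (RtoC r * cis s)%C).
{ intros s. apply (ccont_holo_circle f R0); [ easy | lra ]. }
assert (Cft : forall t, ccont (fun t => f (RtoC r * cis t)%C) t).
{ intros t. now apply (ccont_on_circle f r t t); [ | lra ]. }
assert (HP : forall t, 0 < poisson r w t) by (intros; apply poisson_pos; lra).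
assert (CP : forall t, continuous (poisson r w) t) by (intros; apply poisson_cont; lra).
assert (Cu := fun t => pmean_integrand_cont f r t Cf).
assert (I1 : ex_RInt (fun t => poisson r w t * rpow (Cmod (f (RtoC r * cis t)%C)) p) 0 (2 * PI)).
{ apply ex_RInt_cont; intros t _. now apply cont_Rmult. }
destruct (Rle_lt_or_eq_dec 0 (Cmod (f w)) (Cmod_ge_0 _)) as [Hy|Hy].
2:{ rewrite <- Hy, rpow_npos_eq, Rmult_0_l by lra.
    apply RInt_ge_0; [ lra | exact I1 | ]. intros t _.
    apply Rmult_le_pos; [ left; apply HP | apply rpow_ge0 ]. }
set (y := Cmod (f w)) in *.
destruct (rpow_tangent p y Hp Hy) as [K [HK HT]].
assert (I2 : ex_RInt (fun t => poisson r w t * Cmod (f (RtoC r * cis t)%C)) 0 (2 * PI)).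
{ apply ex_RInt_cont; intros t _. apply cont_Rmult; [ apply CP | ].
  now apply (cont_Cmod (fun t => f (RtoC r * cis t)%C)). }
assert (I3 : ex_RInt (poisson r w) 0 (2 * PI)) by (apply ex_RInt_cont; intros; apply CP).
assert (Low : y * (2 * PI) <= RInt (fun t => poisson r w t * Cmod (f (RtoC r * cis t)%C)) 0 (2 * PI)).
{ replace (y * (2 * PI)) with (Cmod (RtoC (2 * PI) * f w)).
  - rewrite <- (poisson_formula f R0 r w Hf Hr).
    eapply Rle_trans; [ apply Cmod_CInt_le; [ lra | ] | ].
    + intros t _. apply ccont_mult; [ apply ccont_RtoC, CP | apply Cft ].
    + right. apply RInt_ext; intros t _. rewrite Cmod_mult, Cmod_R, Rabs_pos_eq; [ easy | ].
      left; apply HP.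
  - rewrite Cmod_mult, Cmod_R, Rabs_pos_eq by lra. apply Rmult_comm. }
apply Rle_trans with
  (RInt (fun t => (rpow y p - K * y) * poisson r w t
     + K * (poisson r w t * Cmod (f (RtoC r * cis t)%C))) 0 (2 * PI)).
- rewrite RInt_Rplus by now apply ex_RInt_Rscal.
  rewrite !RInt_Rscal by assumption.
  rewrite poisson_mass by lra. nra.
- apply RInt_le; [ lra | | exact I1 | ].
  + apply (ex_RInt_plus (V := R_NormedModule)); now apply ex_RInt_Rscal.
  + intros t _. specialize (HT (Cmod (f (RtoC r * cis t)%C)) (Cmod_ge_0 _)).
    specialize (HP t). nra.
Qed.

(** Average the Poisson majorant over the smaller circle: by symmetry of the
    kernel every point of the larger circle receives the same weight. *)
Lemma pmean_mono (f : C -> C) (R0 s r : R) : holo_disc R0 f -> 0 <= s <= r -> r < R0 ->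
  pmean p f s <= pmean p f r.
Proof.
intros Hf Hsr HR. destruct (Req_dec s r) as [->|Nsr]; [ lra | ].
assert (HPI := PI_RGT_0).
assert (Cf : forall t, Ccont f (RtoC r * cis t)%C).
{ intros t. apply (ccont_holo_circle f R0); [ easy | lra ]. }
assert (Cs : forall t, Ccont f (RtoC s * cis t)%C).
{ intros t. apply (ccont_holo_circle f R0); [ easy | lra ]. }
pose (u := fun t => rpow (Cmod (f (RtoC r * cis t)%C)) p).
assert (Cu : forall t, continuous u t) by (intros; now apply pmean_integrand_cont).
assert (Hs : forall a, Cmod (RtoC s * cis a)%C < r) by (intros; rewrite Cmod_circ; lra).
pose (F := fun a t => poisson r (RtoC s * cis a)%C t * u t).
assert (CF : forall a t, continuous (fun q : R * R => F (fst q) (snd q)) (a, t)).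
{ intros a t. apply cont_Rmult.
  - assert (A1 : ccont (fun q : R * R => RtoC s * cis (fst q))%C (a, t)).
    { apply ccont_mult; [ apply ccont_const | apply ccont_cis, continuous_fst ]. }
    assert (A2 : ccont (fun q : R * R => RtoC r * cis (snd q))%C (a, t)).
    { apply ccont_mult; [ apply ccont_const | apply ccont_cis, continuous_snd ]. }
    apply cont_Rmult.
    + apply cont_Rminus; [ apply continuous_const | ]. now apply cont_pow, cont_Cmod.
    + apply cont_Rinv.
      * apply pow_nonzero. intros E. apply Cmod_eq_0 in E.
        revert E. apply Cminus_neq0, circle_neq, Hs.
      * now apply cont_pow, cont_Cmod, ccont_minus.
  - apply (cont_Rcomp u (fun q : R * R => snd q)); [ apply Cu | apply continuous_snd ]. }
assert (Low : 2 * PI * pmean p f s <= RInt (fun a => RInt (F a) 0 (2 * PI)) 0 (2 * PI)).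
{ unfold pmean. rewrite <- RInt_Rscal by now apply ex_RInt_pmean.
  apply RInt_le; [ lra | apply ex_RInt_Rscal; now apply ex_RInt_pmean | | ].
  - apply ex_RInt_cont; intros a _. apply (cont_RInt_param F).
    + intros; apply CF.
    + apply filter_forall; intros x t _. apply continuous_slice, CF.
  - intros a _. rewrite Rmult_comm. apply (rpow_le_poisson f R0); [ easy | ].
    rewrite Cmod_circ; lra. }
rewrite RInt_Fubini in Low by exact CF.
rewrite (RInt_ext _ (fun t => 2 * PI * u t)) in Low.
- rewrite RInt_Rscal in Low by now apply ex_RInt_pmean.
  apply Rmult_le_reg_l with (2 * PI); [ lra | exact Low ].
- intros t _. unfold F.
  rewrite (RInt_ext _ (fun a => u t * poisson r (RtoC s * cis t)%C a)).
  + rewrite RInt_Rscal.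
    * rewrite poisson_mass by apply Hs. apply Rmult_comm.
    * apply ex_RInt_cont; intros a _. now apply poisson_cont.
  + intros a _. rewrite poisson_sym by lra. apply Rmult_comm.
Qed.

Lemma pmean_ge0 (f : C -> C) (R0 r : R) : holo_disc R0 f -> 0 <= r < R0 -> 0 <= pmean p f r.
Proof.
intros Hf Hr. apply RInt_ge_0; [ generalize PI_RGT_0; lra | | intros; apply rpow_ge0 ].
apply ex_RInt_pmean; intros s. now apply (ccont_holo_circle f R0).
Qed.

(** ** Hardy norms *)

Definition pmean_bound (f : C -> C) (K : R) : Prop :=
  forall r, 0 <= r < 1 -> pmean p f r <= K.

Lemma integral_mean_eq (f : C -> C) (r : R) :
  integral_mean p f r = rpow (/ (2 * PI) * pmean p f r) (/ p).
Proof. reflexivity. Qed.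

Lemma integral_mean_le (f : C -> C) (r N : R) : 0 <= N ->
  integral_mean p f r <= N <-> pmean p f r <= 2 * PI * rpow N p.
Proof.
intros HN. assert (HPI := PI_RGT_0). rewrite integral_mean_eq.
assert (Hi : 0 < / p) by (apply Rinv_0_lt_compat; lra).
assert (H2 : 0 < / (2 * PI)) by (apply Rinv_0_lt_compat; lra).
set (m := pmean p f r).
assert (Em : m = 2 * PI * (/ (2 * PI) * m)) by (field; lra).
set (x := / (2 * PI) * m) in *. split; intros H.
- rewrite Em. apply Rmult_le_compat_l; [ lra | ].
  destruct (Rle_dec x 0) as [Hx|Hx]; [ apply Rle_trans with (1 := Hx), rpow_ge0 | ].
  rewrite <- (rpow_rpow x (/ p) p) by (lra || (field; lra)).
  apply rpow_mono; [ lra | easy ].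
- rewrite Em in H. apply Rmult_le_reg_l in H; [ | lra ].
  apply Rle_trans with (rpow (rpow N p) (/ p)).
  + now apply rpow_mono.
  + right. apply rpow_rpow; [ easy | field; lra ].
Qed.

Lemma integral_mean_ge0 (f : C -> C) (r : R) : 0 <= integral_mean p f r.
Proof. apply rpow_ge0. Qed.

Lemma hardy_norm_ge0 (f : C -> C) : Rbar_le 0 (hardy_norm p f).
Proof.
apply Rbar_le_trans with (Finite (integral_mean p f 0)).
- apply integral_mean_ge0.
- apply (proj1 (Lub_Rbar_correct _)). exists 0; split; [ lra | easy ].
Qed.

Lemma hardy_norm_le_iff (f : C -> C) (N : R) : 0 <= N ->
  Rbar_le (hardy_norm p f) N <-> pmean_bound f (2 * PI * rpow N p).
Proof.
intros HN. split.
- intros H r Hr. apply integral_mean_le; [ easy | ].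
  apply (Rbar_le_trans (Finite _) (hardy_norm p f) N); [ | exact H ].
  apply (proj1 (Lub_Rbar_correct _)). now exists r.
- intros H. apply (proj2 (Lub_Rbar_correct _)). intros m [r [Hr ->]].
  apply integral_mean_le; [ easy | now apply H ].
Qed.

(** Comparing all bounds on the means, instead of suprema, treats finite and
    infinite norms alike. *)
Lemma hardy_norm_le (f g : C -> C) :
  (forall K, pmean_bound g K -> pmean_bound f K) ->
  Rbar_le (hardy_norm p f) (hardy_norm p g).
Proof.
intros H. assert (G := hardy_norm_ge0 g).
destruct (hardy_norm p g) as [N| |] eqn:E; simpl in G; try easy.
- apply hardy_norm_le_iff; [ easy | ]. apply H, hardy_norm_le_iff; [ easy | ].
  rewrite E; apply Rle_refl.
- now destruct (hardy_norm p f).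
Qed.

Lemma hardy_norm_finite_iff (f : C -> C) :
  is_finite (hardy_norm p f) <-> exists K, pmean_bound f K.
Proof.
assert (G := hardy_norm_ge0 f). assert (HPI := PI_RGT_0). split.
- intros H. exists (2 * PI * rpow (real (hardy_norm p f)) p).
  apply hardy_norm_le_iff.
  + rewrite <- H in G. exact G.
  + rewrite H. apply Rbar_le_refl.
- intros [K HK].
  assert (B : Rbar_le (hardy_norm p f) (rpow (Rabs K / (2 * PI)) (/ p))).
  { apply hardy_norm_le_iff; [ apply rpow_ge0 | ].
    rewrite rpow_rpow.
    - replace (2 * PI * (Rabs K / (2 * PI))) with (Rabs K) by (field; lra).
      intros r Hr. apply Rle_trans with (1 := HK r Hr), Rle_abs.
    - apply Rdiv_le_0_compat; [ apply Rabs_pos | lra ].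
    - field; lra. }
  now destruct (hardy_norm p f).
Qed.

Lemma pmean_ext (f g : C -> C) (r : R) : 0 <= r < 1 -> eq_on_disc f g ->
  pmean p f r = pmean p g r.
Proof.
intros Hr H. apply RInt_ext; intros t _. rewrite H; [ easy | ].
unfold in_disc. rewrite Cmod_circ; lra.
Qed.

(** The Poisson kernel is bounded on a circle enclosing [z]. The constant [B]
    depends on [z] only, so the bound applies uniformly to a sequence of
    functions whose means are controlled by the same [K]. *)
Lemma point_bound (z : C) : in_disc z ->
  exists B, forall f K, holo_disc 1 f -> pmean_bound f K -> rpow (Cmod (f z)) p <= B * K.
Proof.
intros Hz. red in Hz. assert (P := Cmod_ge_0 z). assert (HPI := PI_RGT_0).
set (r := (Cmod z + 1) / 2). assert (Hr : Cmod z < r < 1) by (unfold r; lra).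
exists (/ (2 * PI) * (r * r / (r - Cmod z) ^ 2)). intros f K Hf HK.
assert (A := rpow_le_poisson f 1 r z Hf Hr).
assert (Cf : forall t, Ccont f (RtoC r * cis t)%C).
{ intros t. apply (ccont_holo_circle f 1); [ easy | lra ]. }
assert (Hd : 0 < (r - Cmod z) ^ 2) by (apply pow_lt; lra).
set (M := r * r / (r - Cmod z) ^ 2).
assert (HM : 0 <= M) by (apply Rdiv_le_0_compat; [ nra | easy ]).
assert (B : RInt (fun t => poisson r z t * rpow (Cmod (f (RtoC r * cis t)%C)) p) 0 (2 * PI)
            <= M * pmean p f r).
{ unfold pmean. rewrite <- RInt_Rscal by now apply ex_RInt_pmean.
  apply RInt_le; [ lra | | apply ex_RInt_Rscal; now apply ex_RInt_pmean | ].
  - apply ex_RInt_cont; intros t _. apply cont_Rmult.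
    + apply poisson_cont; lra.
    + now apply pmean_integrand_cont.
  - intros t _. apply Rmult_le_compat_r; [ apply rpow_ge0 | ].
    unfold poisson, M. unfold Rdiv. apply Rmult_le_compat.
    + nra.
    + left; apply Rinv_0_lt_compat, pow_lt, Cmod_gt_0, Cminus_neq0, circle_neq; lra.
    + generalize (pow2_ge_0 (Cmod z)); lra.
    + apply Rinv_le_contravar; [ easy | ]. apply pow_incr. split; [ lra | ].
      assert (T := Cmod_triangle (RtoC r * cis t - z) z).
      replace (RtoC r * cis t - z + z)%C with (RtoC r * cis t)%C in T by ring.
      rewrite Cmod_circ in T; lra. }
specialize (HK r ltac:(lra)).
apply Rmult_le_reg_r with (2 * PI); [ lra | ].
apply Rle_trans with (1 := A). apply Rle_trans with (1 := B).
replace (/ (2 * PI) * M * K * (2 * PI)) with (M * K) by (field; lra).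
now apply Rmult_le_compat_l.
Qed.

End Means.

(** * Automorphisms of the disc *)

Lemma moebius_den_neq0 (a z : C) : Cmod a * Cmod z < 1 -> (1 - Cconj a * z)%C <> 0%C.
Proof.
intros H E. assert (E' : (Cconj a * z)%C = 1%C).
{ replace (Cconj a * z)%C with (1 - (1 - Cconj a * z))%C by ring. rewrite E; ring. }
apply (f_equal Cmod) in E'. rewrite Cmod_mult, Cmod_conj, Cmod_1 in E'. lra.
Qed.

Lemma re_Cminus (z w : C) : Re (z - w) = Re z - Re w.
Proof. reflexivity. Qed.

Lemma im_Cminus (z w : C) : Im (z - w) = Im z - Im w.
Proof. reflexivity. Qed.

Lemma Re_moebius_den (a z : C) : Cmod a * Cmod z < 1 -> 0 < Re (1 - Cconj a * z)%C.
Proof.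
intros H. rewrite re_Cminus. simpl (Re 1%C).
generalize (re_le_Cmod (Cconj a * z)). rewrite Cmod_mult, Cmod_conj.
intros H1. generalize (Rle_abs (Re (Cconj a * z))). lra.
Qed.

(** The identity behind the Schwarz-Pick lemma. *)
Lemma moebius_identity (z w : C) :
  Cmod (1 - Cconj w * z) ^ 2 - Cmod (z - w) ^ 2 = (1 - Cmod w ^ 2) * (1 - Cmod z ^ 2).
Proof.
rewrite !Cmod2_alt. destruct z as [x y], w as [u v]; simpl. ring.
Qed.

Lemma Cmod_lt_mult (a z : C) : Cmod a < 1 -> Cmod z <= 1 -> Cmod a * Cmod z < 1.
Proof. intros Ha Hz. generalize (Cmod_ge_0 a) (Cmod_ge_0 z); nra. Qed.

Section Aut.
Variable phi : disc_aut.
Local Notation a := (aut_a phi).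
Local Notation l := (aut_lambda phi).
Local Notation c := (1 - Cmod (aut_a phi) ^ 2).

Lemma aut_a_lt1 : Cmod a < 1.
Proof. exact (aut_aP phi). Qed.

Lemma aut_c_pos : 0 < c.
Proof. generalize aut_a_lt1 (Cmod_ge_0 a); nra. Qed.

Lemma aut_lambda_conj : (Cconj l * l = 1)%C.
Proof. rewrite Cmult_comm, <- Cmod2_conj. rewrite aut_lambdaP. now rewrite pow1. Qed.

Lemma aut_defect (z : C) : Cmod a * Cmod z < 1 ->
  1 - Cmod (phi z) ^ 2 = c * (1 - Cmod z ^ 2) / Cmod (1 - Cconj a * z) ^ 2.
Proof.
intros H. assert (N := moebius_den_neq0 a z H).
assert (P := proj1 (Cmod_gt_0 _) N).
unfold aut_fun. rewrite Cmod_div, Cmod_mult by exact N.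
rewrite aut_lambdaP. rewrite <- moebius_identity. field. lra.
Qed.

Lemma aut_in_disc (z : C) : in_disc z -> in_disc (phi z).
Proof.
unfold in_disc; intros Hz. assert (H := Cmod_lt_mult a z aut_a_lt1 ltac:(lra)).
assert (D := aut_defect z H). assert (Pc := aut_c_pos).
assert (P := proj1 (Cmod_gt_0 _) (moebius_den_neq0 a z H)).
assert (H0 : 0 < c * (1 - Cmod z ^ 2) / Cmod (1 - Cconj a * z) ^ 2).
{ apply Rdiv_lt_0_compat; [ | now apply pow_lt ].
  apply Rmult_lt_0_compat; [ exact Pc | generalize (Cmod_ge_0 z); nra ]. }
rewrite <- D in H0. generalize (Cmod_ge_0 (phi z)); nra.
Qed.

Lemma aut_in_closed_disc (z : C) : Cmod z <= 1 -> Cmod (phi z) <= 1.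
Proof.
intros Hz. assert (H := Cmod_lt_mult a z aut_a_lt1 Hz).
assert (D := aut_defect z H). assert (Pc := aut_c_pos).
assert (P := proj1 (Cmod_gt_0 _) (moebius_den_neq0 a z H)).
assert (H0 : 0 <= c * (1 - Cmod z ^ 2) / Cmod (1 - Cconj a * z) ^ 2).
{ apply Rdiv_le_0_compat; [ | now apply pow_lt ].
  apply Rmult_le_pos; [ lra | generalize (Cmod_ge_0 z); nra ]. }
rewrite <- D in H0. generalize (Cmod_ge_0 (phi z)); nra.
Qed.

Lemma hol_moebius_den (z : C) : hol (fun z => 1 - Cconj a * z)%C z.
Proof.
apply hol_minus; [ apply hol_const | ]. apply hol_mult; [ apply hol_const | apply hol_id ].
Qed.

Lemma hol_aut (z : C) : Cmod z <= 1 -> hol phi z.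
Proof.
intros Hz. apply hol_div.
- apply moebius_den_neq0, Cmod_lt_mult; [ apply aut_a_lt1 | easy ].
- apply hol_mult; [ apply hol_const | ]. apply hol_minus; [ apply hol_id | apply hol_const ].
- apply hol_moebius_den.
Qed.

Definition aut_inv : disc_aut.
Proof.
refine (DiscAut (Cconj l) (- (l * a))%C _ _).
- rewrite Cmod_conj. apply aut_lambdaP.
- unfold in_disc. rewrite Cmod_opp, Cmod_mult. rewrite aut_lambdaP, Rmult_1_l.
  apply aut_a_lt1.
Defined.

Lemma Cmod_aut_inv_a : Cmod (aut_a aut_inv) = Cmod a.
Proof. simpl. rewrite Cmod_opp, Cmod_mult. rewrite aut_lambdaP; ring. Qed.

Lemma aut_inv_den (z : C) : Cmod a * Cmod z < 1 ->
  (1 - Cconj (aut_a aut_inv) * phi z)%C = (RtoC c / (1 - Cconj a * z))%C.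
Proof.
intros H. assert (N := moebius_den_neq0 a z H). cbn [aut_a aut_inv]. unfold aut_fun. fold a l.
rewrite Copp_conj, Cmult_conj.
transitivity (1 + (Cconj l * l) * Cconj a * (z - a) / (1 - Cconj a * z))%C; [ now field | ].
rewrite aut_lambda_conj, RtoC_minus, Cmod2_conj. now field.
Qed.

Lemma aut_invK (z : C) : in_disc z -> aut_inv (phi z) = z.
Proof.
intros Hz. red in Hz. assert (H := Cmod_lt_mult a z aut_a_lt1 ltac:(lra)).
unfold aut_fun at 1. rewrite (aut_inv_den z H). cbn [aut_a aut_lambda aut_inv].
assert (N := moebius_den_neq0 a z H). unfold aut_fun.
assert (Nc : RtoC c <> 0%C).
{ intros E; apply (f_equal Re) in E; simpl in E. generalize aut_c_pos; lra. }
transitivity ((Cconj l * l) * ((z - a) + a * (1 - Cconj a * z)) / RtoC c)%C; [ now field | ].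
rewrite aut_lambda_conj. rewrite RtoC_minus, Cmod2_conj in *. field.
exact Nc.
Qed.

(** ** The weight and its principal root *)

(** The denominator [q] lies in the right half plane, so the argument of
    [1 / q ^ 2] is twice that of [1 / q] without reduction and stays in the
    range where the principal root is given by its polar form. *)
Lemma aut_weight_polar (z : C) : Cmod a * Cmod z < 1 ->
  let q := (1 - Cconj a * z)%C in
  aut_weight phi z = (RtoC (c / Cmod q ^ 2) * cis (- 2 * right_arg q))%C /\
  0 < c / Cmod q ^ 2 /\ - PI < - 2 * right_arg q < PI.
Proof.
intros H q. assert (N := moebius_den_neq0 a z H). fold q in N.
assert (P := proj1 (Cmod_gt_0 _) N). assert (Pc := aut_c_pos).
split; [ | split ].
- unfold aut_weight. fold q.
  assert (E := right_arg_polar q (Re_moebius_den a z H)).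
  set (al := right_arg q) in *.
  replace (- 2 * al) with (- al + - al) by ring. rewrite cis_plus.
  assert (E1 := cis_opp_l al).
  assert (NR : RtoC (Cmod q) <> 0%C).
  { intros F; apply (f_equal Re) in F; simpl in F; lra. }
  assert (E2 : (/ q = cis (- al) / RtoC (Cmod q))%C).
  { transitivity (cis (- al) * cis al / q)%C; [ rewrite E1; now field | ].
    rewrite E at 1. field. split; [ exact NR | ].
    intros F. rewrite F in E1.
    apply (f_equal Re) in E1. simpl in E1. lra. }
  rewrite RtoC_div by (apply pow_nonzero; lra). rewrite RtoC_pow.
  transitivity (RtoC c * (/ q) * (/ q))%C; [ now field | ].
  rewrite E2. now field.
- apply Rdiv_lt_0_compat; [ easy | now apply pow_lt ].
- unfold right_arg. generalize (atan_bound (Im q / Re q)). lra.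
Qed.

Variable p : R.
Hypothesis Hp : 1 <= p.

Definition aut_root (z : C) : C := principal_root p (aut_weight phi z).

Lemma aut_root_polar (z : C) : Cmod a * Cmod z < 1 ->
  let q := (1 - Cconj a * z)%C in
  aut_root z = (RtoC (rpow (c / Cmod q ^ 2) (/ p)) * cis (- 2 * right_arg q / p))%C.
Proof.
intros H q. destruct (aut_weight_polar z H) as [E [H1 H2]].
unfold aut_root. rewrite E. now apply principal_root_polar.
Qed.

Lemma rpow_Cmod_aut_root (z : C) : Cmod a * Cmod z < 1 ->
  rpow (Cmod (aut_root z)) p = c / Cmod (1 - Cconj a * z) ^ 2.
Proof.
intros H. rewrite aut_root_polar by easy.
destruct (aut_weight_polar z H) as [_ [H1 _]]. cbv zeta in H1.
rewrite Cmod_mult, Cmod_cis, Cmod_R, Rmult_1_r, Rabs_pos_eq by apply rpow_ge0.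
apply rpow_rpow; [ lra | field; lra ].
Qed.

(** In this form the root is visibly holomorphic. *)
Lemma aut_root_exp (z : C) : Cmod a * Cmod z < 1 ->
  aut_root z = Cexp (RtoC (ln c / p) - RtoC (2 / p) * Clog (1 - Cconj a * z))%C.
Proof.
intros H. rewrite aut_root_polar by easy.
destruct (aut_weight_polar z H) as [_ [H1 _]]. cbv zeta in H1.
assert (P := proj1 (Cmod_gt_0 _) (moebius_den_neq0 a z H)). assert (Pc := aut_c_pos).
set (q := (1 - Cconj a * z)%C) in *. unfold Cexp, Clog.
rewrite re_Cminus, im_Cminus, re_scal_l, im_scal_l. simpl Re. simpl Im.
f_equal; [ f_equal | f_equal ].
- rewrite rpow_pos_eq by easy. unfold Rpower. f_equal.
  change (c / Cmod q ^ 2) with (c * / Cmod q ^ 2). rewrite ln_mult; [ | easy | now apply Rinv_0_lt_compat, pow_lt ].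
  rewrite ln_Rinv by now apply pow_lt. rewrite ln_pow by easy. simpl. field. lra.
- field. lra.
Qed.

Lemma hol_aut_root (z : C) : Cmod z <= 1 -> hol aut_root z.
Proof.
intros Hz. assert (H := Cmod_lt_mult a z aut_a_lt1 Hz).
apply (hol_ext_loc (fun z => Cexp (RtoC (ln c / p) - RtoC (2 / p) * Clog (1 - Cconj a * z)))%C).
- assert (L : locally (T := C_UniformSpace) z (fun u => Cmod a * Cmod u < 1)).
  { apply (cont_Rmult (U := C_UniformSpace) (fun _ => Cmod a) Cmod z
      (continuous_const _ _) (cont_Cmod (U := C_UniformSpace) (fun u => u) z (continuous_id z))
      (fun x => x < 1)). now apply open_lt. }
  revert L; apply filter_imp; intros u Hu. symmetry. now apply aut_root_exp.
- apply (hol_comp Cexp); [ apply hol_Cexp | ].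
  apply hol_minus; [ apply hol_const | ]. apply hol_mult; [ apply hol_const | ].
  apply (hol_comp Clog); [ apply hol_Clog, Re_moebius_den, H | apply hol_moebius_den ].
Qed.

End Aut.

(** The weights of [phi] and of its inverse are reciprocal, and the principal
    root of a reciprocal is the reciprocal of the principal root. *)
Lemma aut_root_inv (phi : disc_aut) (p : R) (z : C) : 1 <= p -> in_disc z ->
  (aut_root phi p z * aut_root (aut_inv phi) p (phi z) = 1)%C.
Proof.
intros Hp Hz. red in Hz.
assert (H := Cmod_lt_mult _ z (aut_a_lt1 phi) ltac:(lra)).
assert (Hw : Cmod (phi z) <= 1) by (apply aut_in_closed_disc; lra).
assert (H' := Cmod_lt_mult _ _ (aut_a_lt1 (aut_inv phi)) Hw).
destruct (aut_weight_polar phi z H) as [E [H1 H2]]. cbv zeta in E, H1, H2.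
set (r := _ / _) in *. set (t := - 2 * _) in *.
assert (E' : aut_weight (aut_inv phi) (phi z) = (RtoC (/ r) * cis (- t))%C).
{ assert (W : (aut_weight phi z * aut_weight (aut_inv phi) (phi z) = 1)%C).
  { unfold aut_weight. rewrite aut_inv_den, Cmod_aut_inv_a by easy.
    assert (N := moebius_den_neq0 _ z H).
    assert (Nc : RtoC (1 - Cmod (aut_a phi) ^ 2) <> 0%C).
    { intros F; apply (f_equal Re) in F; simpl in F. generalize (aut_c_pos phi); simpl; lra. }
    set (c := RtoC (1 - Cmod (aut_a phi) ^ 2)) in *. field. split; assumption. }
  rewrite E in W.
  assert (F := cis_opp_l t).
  assert (Nr : RtoC r <> 0%C) by (intros G; apply (f_equal Re) in G; simpl in G; lra).
  rewrite RtoC_inv by lra.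
  transitivity (/ RtoC r * cis (- t) *
    (RtoC r * cis t * aut_weight (aut_inv phi) (phi z)))%C.
  - transitivity ((cis (- t) * cis t) * aut_weight (aut_inv phi) (phi z))%C.
    + rewrite F; ring.
    + now field.
  - rewrite W; ring. }
unfold aut_root. rewrite E, E'.
rewrite !principal_root_polar; try lra.
2:{ now apply Rinv_0_lt_compat. }
transitivity (RtoC (rpow r (/ p) * rpow (/ r) (/ p)) * (cis (t / p) * cis (- t / p)))%C.
{ rewrite RtoC_mult; ring. }
rewrite <- rpow_mult by (try (left; apply Rinv_0_lt_compat); lra).
rewrite Rinv_r, rpow_1_l, <- cis_plus by lra.
replace (t / p + - t / p) with 0 by (field; lra). rewrite cis_0; ring.
Qed.

Lemma aut_inv_in_disc_K (phi : disc_aut) (w : C) : in_disc w -> phi (aut_inv phi w) = w.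
Proof.
intros Hw. assert (K := aut_invK (aut_inv phi) w Hw). rewrite <- K at 2.
unfold aut_fun at 1 3. simpl.
assert (L : (Cconj (Cconj (aut_lambda phi)) = aut_lambda phi)%C) by apply Cconj_conj.
rewrite L.
replace (- (Cconj (aut_lambda phi) * - (aut_lambda phi * aut_a phi)))%C with (aut_a phi).
- reflexivity.
- transitivity ((Cconj (aut_lambda phi) * aut_lambda phi) * aut_a phi)%C; [ | ring ].
  rewrite aut_lambda_conj; ring.
Qed.

(** * Change of variables on the circle *)

Lemma unimodular_cis (l : C) : Cmod l = 1 -> exists t, l = cis t.
Proof.
intros H. assert (E := Cmod2_alt l). rewrite H, pow1 in E.
destruct l as [x y]; simpl in E.
assert (Hx : -1 <= x <= 1) by nra.
destruct (Rle_dec 0 y) as [Hy|Hy].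
- exists (acos x). unfold cis. rewrite cos_acos, sin_acos by easy.
  f_equal. rewrite <- (sqrt_Rsqr y) by easy. f_equal. unfold Rsqr; lra.
- exists (- acos x). unfold cis. rewrite cos_neg, sin_neg, cos_acos, sin_acos by easy.
  f_equal. apply Ropp_eq_reg. rewrite Ropp_involutive.
  rewrite <- (sqrt_Rsqr (- y)) by lra. f_equal. unfold Rsqr; lra.
Qed.

Lemma RInt_period_shift (g : R -> R) (A : R) :
  (forall t, continuous g t) -> (forall t, g (t + 2 * PI) = g t) ->
  RInt g A (A + 2 * PI) = RInt g 0 (2 * PI).
Proof.
intros Cg Pg.
assert (I : forall x y, ex_RInt g x y) by (intros; apply ex_RInt_cont; auto).
assert (Ch : forall x y z, RInt g x y + RInt g y z = RInt g x z)
  by (intros; now apply (RInt_Chasles g)).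
assert (S : RInt g (2 * PI) (A + 2 * PI) = RInt g 0 A).
{ replace (2 * PI) with (0 + 2 * PI) at 1 by ring.
  rewrite <- (RInt_comp g (fun t => t + 2 * PI) (fun _ => 1) 0 A).
  - apply RInt_ext; intros t _. rewrite Pg. apply Rmult_1_l.
  - intros; apply Cg.
  - intros t _; split; [ auto_derive; [ easy | ring ] | apply continuous_const ]. }
assert (Z : RInt g A A = 0) by apply (RInt_point A g).
generalize (Ch A 0 (2 * PI)) (Ch A (2 * PI) (A + 2 * PI)) (Ch A 0 A). lra.
Qed.

(** On the circle, [cis t - a] is [cis t] times the conjugate of
    [1 - conj a * cis t], so that an automorphism advances the angle by
    [t - 2 arg (1 - conj a * cis t)] up to a constant; the derivative of this
    angle is the modulus of the weight. *)
Lemma RInt_aut_circle (phi : disc_aut) (G : C -> R) :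
  (forall t, continuous (fun t => G (cis t)) t) ->
  RInt (fun t => (1 - Cmod (aut_a phi) ^ 2) / Cmod (1 - Cconj (aut_a phi) * cis t) ^ 2
                 * G (phi (cis t))) 0 (2 * PI)
  = RInt (fun t => G (cis t)) 0 (2 * PI).
Proof.
intros HG. assert (HPI := PI_RGT_0).
destruct (unimodular_cis (aut_lambda phi) (aut_lambdaP phi)) as [l0 El].
set (a := aut_a phi).
pose (q := fun t => (1 - Cconj a * cis t)%C).
pose (theta := fun t => l0 + (t - 2 * right_arg (q t))).
pose (W := fun t => (1 - Cmod a ^ 2) / Cmod (q t) ^ 2).
assert (Ha : forall t, Cmod a * Cmod (cis t) < 1).
{ intros t. apply Cmod_lt_mult; [ exact (aut_aP phi) | rewrite Cmod_cis; lra ]. }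
assert (Hq : forall t, 0 < Re (q t)) by (intros; apply Re_moebius_den, Ha).
assert (Nq : forall t, q t <> 0%C) by (intros; apply moebius_den_neq0, Ha).
assert (Ephi : forall t, phi (cis t) = cis (theta t)).
{ intros t. unfold theta. rewrite cis_plus, <- El.
  unfold aut_fun. fold a. fold (q t).
  assert (E := right_arg_polar (q t) (Hq t)). set (al := right_arg (q t)) in *.
  assert (E1 : (cis t - a = cis t * Cconj (q t))%C).
  { unfold q. rewrite Cminus_conj, Cmult_conj, Cconj_conj, Cconj_cis.
    rewrite Cconj_RtoC.
    transitivity (cis t - a * (cis (- t) * cis t))%C; [ rewrite cis_opp_l; ring | ring ]. }
  assert (E2 : (Cconj (q t) = cis (- al) * cis (- al) * q t)%C).
  { rewrite E at 1. rewrite Cmult_conj, Cconj_cis.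
    rewrite Cconj_RtoC.
    rewrite E at 2.
    transitivity (RtoC (Cmod (q t)) * cis (- al) * (cis (- al) * cis al))%C; [ | ring ].
    rewrite cis_opp_l; ring. }
  rewrite E1, E2. replace (t - 2 * al) with (t + (- al + - al)) by ring.
  rewrite !cis_plus. field. apply Nq. }
assert (Dtheta : forall t, is_derive theta t (W t)).
{ intros t. specialize (Hq t). unfold theta, W, q, right_arg. unfold q in Hq.
  assert (Ea := Cmod2_alt (q t)). unfold q in Ea.
  rewrite Ea, (Cmod2_alt a). destruct a as [x y]. unfold cis in *. simpl in *.
  auto_derive.
  - lra.
  - generalize (sin2_cos2 t); unfold Rsqr; intros S.
    set (s := sin t) in *. set (k := cos t) in *.
    set (X := 1 + - (x * k - - y * s)) in *.
    set (Y := 0 + - (x * s + - y * k)) in *.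
    replace (1 + - (x * k + - (- y * s))) with X by (unfold X; ring).
    replace (- (x * (1 * k) + - y * (1 * - s))) with (X - 1) by (unfold X; ring).
    replace (- - (x * (1 * - s) + - (- y * (1 * k)))) with Y by (unfold Y; ring).
    assert (E : x * x + y * y = (1 - X) * (1 - X) + Y * Y).
    { transitivity ((x * x + y * y) * (s * s + k * k)); [ rewrite S; ring | ].
      unfold X, Y; ring. }
    replace (x * (x * 1) + y * (y * 1)) with ((1 - X) * (1 - X) + Y * Y)
      by (rewrite <- E; ring).
    field. split; nra. }
assert (Cq : forall t, ccont q t).
{ intros t. apply ccont_minus; [ apply ccont_const | ].
  apply ccont_mult; [ apply ccont_const | apply ccont_cis, continuous_id ]. }
assert (CW : forall t, continuous W t).
{ intros t. apply cont_Rmult; [ apply continuous_const | ]. apply cont_Rinv.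
  - apply pow_nonzero. intros F. now apply (Nq t), Cmod_eq_0.
  - now apply cont_pow, cont_Cmod. }
pose (g := fun t => G (cis t)).
assert (Pg : forall t, g (t + 2 * PI) = g t) by (intros; unfold g; now rewrite cis_period).
transitivity (RInt g (theta 0) (theta (2 * PI))).
- rewrite <- (RInt_comp g theta W 0 (2 * PI)).
  + apply RInt_ext; intros t _. now rewrite Ephi.
  + intros; apply HG.
  + intros t _; split; [ apply Dtheta | apply CW ].
- replace (theta (2 * PI)) with (theta 0 + 2 * PI).
  + now apply RInt_period_shift.
  + unfold theta, q. rewrite <- (Rplus_0_l (2 * PI)) at 2 3.
    rewrite cis_period. ring.
Qed.

(** * The operators U and M_psi *)

(** Approaching radius 1 along [1 - x ^ 2] keeps all points in the closed
    disc. *)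
Lemma radial_limit (F : R -> R -> R) (eps s0 : R) :
  (forall x t, Rabs x < 1 -> continuous (fun q : R * R => F (1 - fst q ^ 2) (snd q)) (x, t)) ->
  0 < eps -> s0 < 1 ->
  exists s, s0 < s < 1 /\ 0 <= s /\
    Rabs (RInt (F s) 0 (2 * PI) - RInt (F 1) 0 (2 * PI)) < eps.
Proof.
intros HF He Hs0.
assert (R01 : Rabs 0 < 1) by (rewrite Rabs_R0; lra).
assert (Cm : continuous (fun x => RInt (F (1 - x ^ 2)) 0 (2 * PI)) 0).
{ apply (cont_RInt_param (fun x t => F (1 - x ^ 2) t)).
  - intros t _. now apply HF.
  - generalize (cont_Rabs_lt 0 1 R01); apply filter_imp; intros x Hx t _.
    apply (continuous_slice (fun x t => F (1 - x ^ 2) t)). now apply HF. }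
destruct (proj1 (filterlim_locally _ _) Cm (mkposreal _ He)) as [d Hd].
(* The two inner bounds give x ^ 2 <= x / 2 < 1 - s0. *)
pose (x := Rmin (d / 2) (Rmin (/ 2) (1 - s0))).
assert (Hx : 0 < x /\ x < d /\ x <= / 2 /\ x <= 1 - s0).
{ assert (P := cond_pos d). unfold x.
  generalize (Rmin_l (d / 2) (Rmin (/ 2) (1 - s0))) (Rmin_r (d / 2) (Rmin (/ 2) (1 - s0)))
    (Rmin_l (/ 2) (1 - s0)) (Rmin_r (/ 2) (1 - s0)).
  assert (0 < Rmin (d / 2) (Rmin (/ 2) (1 - s0))) by (repeat apply Rmin_pos; lra). lra. }
exists (1 - x ^ 2). split; [ nra | split; [ nra | ] ].
assert (B : ball 0 d x).
{ change (Rabs (x - 0) < d). rewrite Rminus_0_r, Rabs_pos_eq; lra. }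
specialize (Hd x B).
change (Rabs (RInt (F (1 - x ^ 2)) 0 (2 * PI) - RInt (F (1 - 0 ^ 2)) 0 (2 * PI)) < eps) in Hd.
now replace (1 - 0 ^ 2) with 1 in Hd by ring.
Qed.

Lemma radius_sqr (x : R) : Rabs x < 1 -> 0 < 1 - x ^ 2 <= 1.
Proof. intros H; apply Rabs_def2 in H. nra. Qed.

Lemma cont_radius (q : R * R) : continuous (fun q : R * R => 1 - fst q ^ 2) q.
Proof.
apply cont_Rminus; [ apply continuous_const | apply cont_pow ].
destruct q; apply continuous_fst.
Qed.

Section Operators.
Variable p : R.
Hypothesis Hp : 1 <= p.

Section Uop.
Variable phi : disc_aut.

Lemma U_opE (f : C -> C) (z : C) : U_op p phi f z = (aut_root phi p z * f (phi z))%C.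
Proof. reflexivity. Qed.

Lemma hol_U (f : C -> C) (z : C) : Cmod z <= 1 -> hol f (phi z) -> hol (U_op p phi f) z.
Proof.
intros Hz Hf. apply hol_mult; [ now apply (hol_aut_root phi p Hp) | ].
apply (hol_comp f phi); [ exact Hf | now apply hol_aut ].
Qed.

Lemma holo_U (f : C -> C) : holo_disc 1 f -> holo_disc 1 (U_op p phi f).
Proof. intros Hf z Hz. apply hol_U; [ lra | ]. now apply Hf, aut_in_disc. Qed.

Lemma rpow_Cmod_U (f : C -> C) (z : C) : Cmod z <= 1 ->
  rpow (Cmod (U_op p phi f z)) p =
  (1 - Cmod (aut_a phi) ^ 2) / Cmod (1 - Cconj (aut_a phi) * z) ^ 2 * rpow (Cmod (f (phi z))) p.
Proof.
intros Hz. rewrite U_opE, Cmod_mult, rpow_mult by apply Cmod_ge_0.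
rewrite rpow_Cmod_aut_root; [ reflexivity | exact Hp | ].
apply Cmod_lt_mult; [ apply aut_a_lt1 | easy ].
Qed.

(** For functions holomorphic beyond the closed disc the change of variables
    on the unit circle applies; the smaller circles follow by monotonicity. *)
Lemma pmean_U_smooth (h : C -> C) (R0 r : R) : 1 < R0 -> holo_disc R0 h -> 0 <= r < 1 ->
  pmean p (U_op p phi h) r <= pmean p h 1.
Proof.
intros HR Hh Hr.
assert (Hh1 : holo_disc 1 h) by (intros z Hz; apply Hh; lra).
assert (E : pmean p (U_op p phi h) 1 = pmean p h 1).
{ unfold pmean. transitivity (RInt (fun t => rpow (Cmod (h (cis t))) p) 0 (2 * PI)).
  2:{ apply RInt_ext; intros t _. now rewrite Cmult_1_l. }
  rewrite <- (RInt_aut_circle phi (fun z => rpow (Cmod (h z)) p)).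
  - apply RInt_ext; intros t _. rewrite Cmult_1_l. apply rpow_Cmod_U.
    rewrite Cmod_cis; lra.
  - intros t. apply (cont_rpow_Cmod p Hp (fun t => h (cis t))).
    apply ccont_comp; [ | apply ccont_cis, continuous_id ].
    apply hol_cont, Hh. rewrite Cmod_cis; lra. }
apply le_epsilon; intros eps He.
destruct (radial_limit (fun s t => rpow (Cmod (U_op p phi h (RtoC s * cis t)%C)) p) eps r)
  as [s [H1 [H2 H3]]].
- intros x t Hx. assert (Q := radius_sqr x Hx).
  apply (cont_rpow_Cmod p Hp
    (fun q : R * R => U_op p phi h (RtoC (1 - fst q ^ 2) * cis (snd q))%C)).
  apply (ccont_circle (U_op p phi h) (fun q : R * R => 1 - fst q ^ 2) (fun q : R * R => snd q)).
  + apply hol_cont. simpl fst; simpl snd.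
    assert (Hz : Cmod (RtoC (1 - x ^ 2) * cis t) <= 1) by (rewrite Cmod_circ; lra).
    apply hol_U; [ exact Hz | ]. apply Hh.
    apply Rle_lt_trans with 1; [ now apply aut_in_closed_disc | exact HR ].
  + apply cont_radius.
  + apply continuous_snd.
- exact He.
- lra.
- rewrite <- E. apply Rle_trans with (pmean p (U_op p phi h) s).
  + apply (pmean_mono p Hp _ 1); [ now apply holo_U | lra | lra ].
  + apply Rabs_def2 in H3. unfold pmean. lra.
Qed.

(** Apply the smooth case to the dilations [z |-> f (s z)] and let [s] tend
    to 1. *)
Lemma pmean_bound_U (f : C -> C) (K : R) : holo_disc 1 f ->
  pmean_bound p f K -> pmean_bound p (U_op p phi f) K.
Proof.
intros Hf HK r Hr. apply le_epsilon; intros eps He.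
pose (fs := fun s z => f (RtoC s * z)%C).
destruct (radial_limit (fun s t => rpow (Cmod (U_op p phi (fs s) (RtoC r * cis t)%C)) p) eps 0)
  as [s [H1 [H2 H3]]].
- intros x t Hx. assert (Q := radius_sqr x Hx).
  apply (cont_rpow_Cmod p Hp
    (fun q : R * R => U_op p phi (fs (1 - fst q ^ 2)) (RtoC r * cis (snd q))%C)).
  assert (Hz : Cmod (RtoC r * cis t) < 1) by (rewrite Cmod_circ; lra).
  assert (Cz : ccont (fun q : R * R => RtoC r * cis (snd q))%C (x, t)).
  { apply ccont_mult; [ apply ccont_const | apply ccont_cis, continuous_snd ]. }
  apply ccont_mult.
  + apply (ccont_comp (aut_root phi p)); [ | exact Cz ].
    apply hol_cont, (hol_aut_root phi p Hp). simpl; lra.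
  + apply (ccont_comp f (fun q : R * R => RtoC (1 - fst q ^ 2) * phi (RtoC r * cis (snd q)))%C).
    * apply hol_cont, Hf. simpl fst; simpl snd.
      assert (B : Cmod (phi (RtoC r * cis t)%C) < 1) by now apply aut_in_disc.
      rewrite Cmod_mult, Cmod_R, Rabs_pos_eq by lra.
      generalize (Cmod_ge_0 (phi (RtoC r * cis t)%C)); nra.
    * apply ccont_mult; [ apply ccont_RtoC, cont_radius | ].
      apply (ccont_comp phi); [ | exact Cz ].
      apply hol_cont, hol_aut. simpl; lra.
- exact He.
- lra.
- assert (B : pmean p (U_op p phi (fs s)) r <= K).
  { apply Rle_trans with (pmean p (fs s) 1).
    - apply (pmean_U_smooth _ (/ s)); [ | | easy ].
      + rewrite <- Rinv_1. apply Rinv_lt_contravar; lra.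
      + intros z Hz. apply (hol_comp f (fun z => RtoC s * z)%C).
        * apply Hf. rewrite Cmod_mult, Cmod_R, Rabs_pos_eq by lra.
          apply Rmult_lt_reg_l with (/ s); [ apply Rinv_0_lt_compat; lra | ].
          rewrite <- Rmult_assoc, Rinv_l by lra. lra.
        * apply hol_mult; [ apply hol_const | apply hol_id ].
    - replace (pmean p (fs s) 1) with (pmean p f s); [ apply HK; lra | ].
      apply RInt_ext; intros t _. unfold fs. now rewrite Cmult_1_l. }
  replace (pmean p (U_op p phi f) r)
    with (RInt (fun t => rpow (Cmod (U_op p phi (fs 1) (RtoC r * cis t)%C)) p) 0 (2 * PI)).
  + apply Rabs_def2 in H3. unfold pmean in B. lra.
  + apply RInt_ext; intros t _. unfold fs. rewrite !U_opE. now rewrite Cmult_1_l.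
Qed.

End Uop.

Lemma pmean_bound_ext (f g : C -> C) (K : R) : eq_on_disc f g ->
  pmean_bound p f K -> pmean_bound p g K.
Proof. intros E H r Hr. rewrite <- (pmean_ext p f g r Hr E). now apply H. Qed.

Lemma U_invK (phi : disc_aut) (f : C -> C) :
  eq_on_disc (U_op p (aut_inv phi) (U_op p phi f)) f.
Proof.
intros w Hw. rewrite !U_opE, aut_inv_in_disc_K by easy.
assert (H := aut_root_inv phi p (aut_inv phi w) Hp (aut_in_disc (aut_inv phi) w Hw)).
rewrite aut_inv_in_disc_K in H by easy.
rewrite Cmult_assoc, (Cmult_comm (aut_root (aut_inv phi) p w)), H. ring.
Qed.

Lemma U_Kinv (phi : disc_aut) (f : C -> C) :
  eq_on_disc (U_op p phi (U_op p (aut_inv phi) f)) f.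
Proof.
intros z Hz. rewrite !U_opE, aut_invK by easy.
rewrite Cmult_assoc, aut_root_inv by easy. ring.
Qed.

(** The operators of [phi] and of its inverse are both contractions and are
    inverse to each other. *)
Lemma pmean_bound_U_iff (phi : disc_aut) (f : C -> C) (K : R) : holo_disc 1 f ->
  pmean_bound p (U_op p phi f) K <-> pmean_bound p f K.
Proof.
intros Hf; split; [ | now apply pmean_bound_U ].
intros H. apply (pmean_bound_ext _ _ _ (U_invK phi f)).
apply pmean_bound_U; [ now apply holo_U | exact H ].
Qed.

(** ** Multiplication by an automorphism *)

Lemma holo_mul_aut (psi : disc_aut) (f : C -> C) : holo_disc 1 f -> holo_disc 1 (mul_op psi f).
Proof. intros Hf z Hz. apply hol_mult; [ apply hol_aut; lra | now apply Hf ]. Qed.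

(** By [aut_defect], [1 - |psi z| ^ 2] is at most a constant times
    [1 - |z| ^ 2], the constant being governed by [|1 - conj a * z| >= 1 - |a|]. *)
Lemma aut_modulus_near_1 (psi : disc_aut) (b : R) : b < 1 ->
  exists s0, s0 < 1 /\ forall z, s0 < Cmod z < 1 -> b <= Cmod (psi z).
Proof.
intros Hb. assert (Ha := aut_a_lt1 psi). assert (Ha0 := Cmod_ge_0 (aut_a psi)).
set (a := aut_a psi) in *. assert (Pc := aut_c_pos psi). fold a in Pc.
set (k := (1 - Cmod a) ^ 2). assert (Pk : 0 < k) by (unfold k; nra).
exists (1 - k * (1 - b) / 2). split; [ nra | ].
intros z Hz. assert (Hm := Cmod_lt_mult a z Ha ltac:(lra)).
assert (D := aut_defect psi z Hm). fold a in D.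
assert (Pz := Cmod_ge_0 z).
assert (Q : k <= Cmod (1 - Cconj a * z) ^ 2).
{ apply pow_incr. split; [ lra | ].
  assert (T := Cmod_triangle (1 - Cconj a * z) (Cconj a * z)).
  replace (1 - Cconj a * z + Cconj a * z)%C with (RtoC 1) in T by ring.
  rewrite Cmod_1, Cmod_mult, Cmod_conj in T. nra. }
set (Qz := Cmod (1 - Cconj a * z) ^ 2) in *.
assert (A : (1 - Cmod a ^ 2) * (1 - Cmod z ^ 2) / Qz <= 1 - b).
{ apply Rle_div_l; [ lra | ].
  apply Rle_trans with (1 * (k * (1 - b))).
  - apply Rmult_le_compat; nra.
  - rewrite Rmult_1_l, Rmult_comm. apply Rmult_le_compat_l; lra. }
rewrite <- D in A. generalize (Cmod_ge_0 (psi z)). intros P1.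
assert (P2 : Cmod (psi z) < 1) by (apply aut_in_disc; red; lra). nra.
Qed.

(** Since [|psi| <= 1] only one direction has content: the means increase with
    the radius, and [|psi|] tends to 1 at the boundary. *)
Lemma pmean_bound_mul_iff (psi : disc_aut) (f : C -> C) (K : R) : holo_disc 1 f ->
  pmean_bound p (mul_op psi f) K <-> pmean_bound p f K.
Proof.
intros Hf. assert (HPI := PI_RGT_0).
assert (Hm := holo_mul_aut psi f Hf).
assert (I1 : forall s, 0 <= s < 1 ->
  ex_RInt (fun t => rpow (Cmod (mul_op psi f (RtoC s * cis t)%C)) p) 0 (2 * PI)).
{ intros s Hs. apply (ex_RInt_pmean p Hp). intros t. now apply (ccont_holo_circle _ 1). }
assert (I2 : forall s, 0 <= s < 1 ->
  ex_RInt (fun t => rpow (Cmod (f (RtoC s * cis t)%C)) p) 0 (2 * PI)).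
{ intros s Hs. apply (ex_RInt_pmean p Hp). intros t. now apply (ccont_holo_circle _ 1). }
split; intros H r Hr.
- (* Compare on a circle of radius s close to 1, where |psi| >= b. *)
  assert (Hb : forall b, 0 <= b < 1 -> rpow b p * pmean p f r <= K).
  { intros b Hb. destruct (aut_modulus_near_1 psi b ltac:(lra)) as [s0 [Hs0 Hpsi]].
    pose (s := (Rmax r s0 + 1) / 2).
    assert (Rmax r s0 < 1) by (apply Rmax_lub_lt; lra).
    generalize (Rmax_l r s0) (Rmax_r r s0); intros L1 L2.
    assert (Hs : r < s /\ s0 < s /\ s < 1) by (unfold s; lra).
    apply Rle_trans with (rpow b p * pmean p f s).
    { apply Rmult_le_compat_l; [ apply rpow_ge0 | ].
      apply (pmean_mono p Hp f 1); [ easy | lra | lra ]. }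
    apply Rle_trans with (pmean p (mul_op psi f) s); [ | apply H; lra ].
    unfold pmean. rewrite <- RInt_Rscal by (apply I2; lra).
    apply RInt_le; [ lra | apply ex_RInt_Rscal, I2; lra | apply I1; lra | ].
    intros t _. unfold mul_op. rewrite Cmod_mult, rpow_mult by apply Cmod_ge_0.
    apply Rmult_le_compat_r; [ apply rpow_ge0 | ].
    apply rpow_mono; [ lra | ]. apply Hpsi. rewrite Cmod_circ; lra. }
  apply le_epsilon; intros eps He.
  assert (M0 : 0 <= pmean p f r) by (now apply (pmean_ge0 p Hp f 1)).
  set (M := pmean p f r) in *.
  assert (Cb : continuous (fun b => rpow b p * M) 1).
  { apply cont_Rmult; [ apply rpow_cont; lra | apply continuous_const ]. }
  destruct (proj1 (filterlim_locally _ _) Cb (mkposreal _ He)) as [d Hd].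
  pose (b := 1 - Rmin (d / 2) (/ 2)).
  assert (P := cond_pos d).
  assert (Hm1 : 0 < Rmin (d / 2) (/ 2)) by (apply Rmin_pos; lra).
  generalize (Rmin_l (d / 2) (/ 2)) (Rmin_r (d / 2) (/ 2)); intros L1 L2.
  assert (B : ball 1 d b).
  { change (Rabs (b - 1) < d). unfold b. rewrite Rabs_left; lra. }
  specialize (Hd b B). change (Rabs (rpow b p * M - rpow 1 p * M) < eps) in Hd.
  rewrite rpow_1_l in Hd. apply Rabs_def2 in Hd.
  specialize (Hb b ltac:(unfold b; lra)). lra.
- apply Rle_trans with (2 := H r Hr).
  unfold pmean. apply RInt_le; [ lra | now apply I1 | now apply I2 | ].
  intros t _. apply rpow_mono; [ lra | ]. unfold mul_op. rewrite Cmod_mult.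
  assert (Cmod (psi (RtoC r * cis t)%C) <= 1).
  { apply aut_in_closed_disc. rewrite Cmod_circ; lra. }
  generalize (Cmod_ge_0 (f (RtoC r * cis t)%C)); nra.
Qed.

(** * The composed operator *)

Definition MU_op (phi psi : disc_aut) (f : C -> C) : C -> C := mul_op psi (U_op p phi f).

Section Composite.
Variables phi psi : disc_aut.
Local Notation MU := (MU_op phi psi).

Lemma MU_E (f : C -> C) (z : C) : MU f z = (psi z * (aut_root phi p z * f (phi z)))%C.
Proof. reflexivity. Qed.

Lemma pmean_bound_MU_iff (f : C -> C) (K : R) : holo_disc 1 f ->
  pmean_bound p (MU f) K <-> pmean_bound p f K.
Proof.
intros Hf. unfold MU_op. rewrite pmean_bound_mul_iff by now apply holo_U.
now apply pmean_bound_U_iff.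
Qed.

Lemma holo_MU (f : C -> C) : holo_disc 1 f -> holo_disc 1 (MU f).
Proof. intros; now apply holo_mul_aut, holo_U. Qed.

Lemma in_Hp_iff (f : C -> C) :
  in_Hp p f <-> holo_disc 1 f /\ exists K, pmean_bound p f K.
Proof. unfold in_Hp. now rewrite hardy_norm_finite_iff. Qed.

Lemma in_Hp_MU (f : C -> C) : in_Hp p f -> in_Hp p (MU f).
Proof.
rewrite !in_Hp_iff. intros [Hf [K HK]]; split; [ now apply holo_MU | ].
exists K. now apply pmean_bound_MU_iff.
Qed.

Lemma hardy_norm_MU (f : C -> C) : in_Hp p f -> hardy_norm p (MU f) = hardy_norm p f.
Proof.
intros [Hf _]. apply Rbar_le_antisym; apply (hardy_norm_le p Hp); intros K;
  now rewrite pmean_bound_MU_iff.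
Qed.

Lemma aut_zero : psi (aut_a psi) = 0%C.
Proof. unfold aut_fun, Cdiv. ring. Qed.

(** The zero of [psi] is simple and is a removable singularity of the
    quotient; the remaining factors of [psi] have no zero in the disc. *)
Lemma divide_aut (g : C -> C) : holo_disc 1 g -> g (aut_a psi) = 0%C ->
  exists q, holo_disc 1 q /\ eq_on_disc g (mul_op psi q).
Proof.
intros Hg H0.
destruct (hol_divide_root g 1 (aut_a psi) Hg (aut_aP psi) H0) as [q [Hq Eq]].
exists (fun z => Cconj (aut_lambda psi) * (1 - Cconj (aut_a psi) * z) * q z)%C; split.
- intros z Hz. apply hol_mult; [ | now apply Hq ].
  apply hol_mult; [ apply hol_const | apply hol_moebius_den ].
- intros z Hz. rewrite (Eq z Hz). red in Hz. unfold mul_op, aut_fun.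
  assert (N := moebius_den_neq0 (aut_a psi) z (Cmod_lt_mult _ z (aut_a_lt1 psi) ltac:(lra))).
  transitivity ((Cconj (aut_lambda psi) * aut_lambda psi) * ((z - aut_a psi) * q z))%C.
  + rewrite aut_lambda_conj. ring.
  + now field.
Qed.

Lemma MU_onto (g : C -> C) : in_Hp p g -> g (aut_a psi) = 0%C -> in_power_range p MU 1 g.
Proof.
rewrite in_Hp_iff. intros [Hg [K HK]] H0.
destruct (divide_aut g Hg H0) as [q [Hq Eq]].
assert (Kq : pmean_bound p q K).
{ apply (pmean_bound_mul_iff psi q K Hq). exact (pmean_bound_ext _ _ _ Eq HK). }
exists (U_op p (aut_inv phi) q). split.
- apply in_Hp_iff. split; [ now apply holo_U | ].
  exists K. now apply pmean_bound_U.
- intros z Hz. rewrite (Eq z Hz). 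
  change (psi z * q z = psi z * U_op p phi (U_op p (aut_inv phi) q) z)%C.
  now rewrite U_Kinv.
Qed.

Lemma in_Hp_const (c : C) : in_Hp p (fun _ => c).
Proof.
apply in_Hp_iff. split; [ intros z _; apply hol_const | ].
exists ((2 * PI) * rpow (Cmod c) p). intros r _. right.
unfold pmean. rewrite RInt_const. unfold scal; simpl; unfold mult; simpl. ring.
Qed.

Lemma in_Hp_minus_const (g : C -> C) (c : C) : in_Hp p g -> in_Hp p (fun z => g z - c)%C.
Proof.
rewrite !in_Hp_iff. intros [Hg [K HK]]. assert (HPI := PI_RGT_0).
assert (Hgc : holo_disc 1 (fun z => g z - c)%C).
{ intros z Hz. apply hol_minus; [ now apply Hg | apply hol_const ]. }
split; [ easy | ].
(* |u - c|^p <= 2^p max (|u|, |c|)^p <= 2^p (|u|^p + |c|^p) *)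
exists (rpow 2 p * K + rpow 2 p * (2 * PI * rpow (Cmod c) p)). intros r Hr.
apply Rle_trans with
  (RInt (fun t => rpow 2 p * rpow (Cmod (g (RtoC r * cis t)%C)) p
                  + rpow 2 p * rpow (Cmod c) p) 0 (2 * PI)).
- assert (I := ex_RInt_pmean p Hp g r (fun s => ccont_holo_circle g 1 r s Hg Hr)).
  apply RInt_le; [ lra | | | ].
  + apply (ex_RInt_pmean p Hp (fun z => g z - c)%C). intros s.
    now apply (ccont_holo_circle _ 1).
  + apply (ex_RInt_plus (V := R_NormedModule)); [ now apply ex_RInt_Rscal | apply ex_RInt_const ].
  + intros t _. set (u := g _).
    assert (T : Cmod (u - c) <= 2 * Rmax (Cmod u) (Cmod c)).
    { apply Rle_trans with (1 := Cmod_triangle _ _). rewrite Cmod_opp.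
      generalize (Rmax_l (Cmod u) (Cmod c)) (Rmax_r (Cmod u) (Cmod c)); lra. }
    apply Rle_trans with (rpow (2 * Rmax (Cmod u) (Cmod c)) p).
    { apply rpow_mono; [ lra | exact T ]. }
    assert (M := Rmax_l (Cmod u) (Cmod c)). assert (M0 := Cmod_ge_0 u).
    rewrite rpow_mult, <- Rmult_plus_distr_l by lra.
    apply Rmult_le_compat_l; [ apply rpow_ge0 | ].
    generalize (rpow_ge0 (Cmod u) p) (rpow_ge0 (Cmod c) p).
    unfold Rmax; destruct (Rle_dec (Cmod u) (Cmod c)); lra.
- assert (I := ex_RInt_pmean p Hp g r (fun s => ccont_holo_circle g 1 r s Hg Hr)).
  rewrite RInt_Rplus; [ | now apply ex_RInt_Rscal | apply ex_RInt_const ].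
  rewrite RInt_Rscal by exact I. rewrite RInt_const.
  apply Rplus_le_compat.
  + apply Rmult_le_compat_l; [ apply rpow_ge0 | now apply HK ].
  + right. unfold scal; simpl; unfold mult; simpl. ring.
Qed.

(** The range consists of the functions that vanish at the zero of [psi], so
    the constants are a complement. *)
Lemma MU_codim_one_isometry : codim_one_isometry p MU.
Proof.
split.
- intros f g _ _ E z Hz. rewrite !MU_E. now rewrite E by now apply aut_in_disc.
- exact in_Hp_MU.
- intros c f g _ _ z Hz. rewrite !MU_E. ring.
- exact hardy_norm_MU.
- exists (fun _ => RtoC 1). split; [ apply in_Hp_const | split ].
  + intros [f [_ E]]. specialize (E (aut_a psi) (aut_aP psi)).
    change (RtoC 1 = MU f (aut_a psi)) in E. rewrite MU_E, aut_zero, Cmult_0_l in E.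
    apply (f_equal Re) in E; simpl in E; lra.
  + intros g Hg. exists (g (aut_a psi)).
    apply MU_onto.
    * now apply (in_Hp_minus_const (fun z => g z) (g (aut_a psi) * 1)%C).
    * ring.
Qed.

(** ** The Crownover property *)

(** The quantity is 1 minus the square of the pseudo-hyperbolic distance. *)
Lemma schwarz_pick (z w : C) : in_disc z -> in_disc w ->
  (1 - Cmod (phi z) ^ 2) * (1 - Cmod (phi w) ^ 2) / Cmod (1 - Cconj (phi w) * phi z) ^ 2
  = (1 - Cmod z ^ 2) * (1 - Cmod w ^ 2) / Cmod (1 - Cconj w * z) ^ 2.
Proof.
intros Hz Hw. red in Hz, Hw. assert (Ha := aut_a_lt1 phi). assert (Pc := aut_c_pos phi).
assert (Hz1 := Cmod_lt_mult _ z Ha ltac:(lra)). assert (Hw1 := Cmod_lt_mult _ w Ha ltac:(lra)).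
assert (Hwz := Cmod_lt_mult w z Hw ltac:(lra)).
rewrite !aut_defect by easy.
assert (Nz := moebius_den_neq0 _ z Hz1). assert (Nw := moebius_den_neq0 _ w Hw1).
assert (Nwz := moebius_den_neq0 _ z Hwz).
set (a := aut_a phi) in *. set (c := 1 - Cmod a ^ 2) in *.
assert (Nw' : Cconj (1 - Cconj a * w) <> 0%C).
{ intros F. apply Nw. rewrite <- (Cconj_conj (1 - Cconj a * w)), F.
  apply injective_projections; simpl; ring. }
assert (E : (1 - Cconj (phi w) * phi z =
  RtoC c * (1 - Cconj w * z) / (Cconj (1 - Cconj a * w) * (1 - Cconj a * z)))%C).
{ unfold aut_fun. fold a. rewrite Cdiv_conj, Cmult_conj, !Cminus_conj by exact Nw.
  rewrite Cminus_conj in Nw'. rewrite Cmult_conj, Cconj_conj in Nw' |- *.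
  rewrite Cconj_RtoC in Nw' |- *.
  transitivity (1 - (Cconj (aut_lambda phi) * aut_lambda phi) *
    (Cconj w - Cconj a) * (z - a) / ((1 - a * Cconj w) * (1 - Cconj a * z)))%C.
  { field. now split. }
  rewrite aut_lambda_conj. unfold c. rewrite RtoC_minus, Cmod2_conj.
  field. now split. }
rewrite E, Cmod_div, !Cmod_mult, Cmod_conj, Cmod_R, Rabs_pos_eq by
  (try lra; now apply Cmult_neq_0).
apply Cmod_gt_0 in Nz. apply Cmod_gt_0 in Nw. apply Cmod_gt_0 in Nwz.
field. repeat split; lra.
Qed.

(** The orbit of [z] stays on a pseudo-hyperbolic circle about the fixed
    point, hence in a compact part of the disc, where [|psi|] is bounded away
    from 1. *)
Lemma orbit_bound (alpha z : C) : in_disc alpha -> phi alpha = alpha -> in_disc z ->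
  exists rho, 0 <= rho < 1 /\ forall n, Cmod (psi (Nat.iter n phi z)) <= rho.
Proof.
intros Hal Efix Hz.
pose (kap := fun u => (1 - Cmod u ^ 2) * (1 - Cmod alpha ^ 2) / Cmod (1 - Cconj alpha * u) ^ 2).
assert (Orb : forall n, in_disc (Nat.iter n phi z) /\ kap (Nat.iter n phi z) = kap z).
{ induction n as [|n [IH1 IH2]]; [ easy | ]. simpl. split; [ now apply aut_in_disc | ].
  rewrite <- IH2. unfold kap.
  generalize (schwarz_pick (Nat.iter n phi z) alpha IH1 Hal). now rewrite Efix. }
red in Hal. assert (P0 := Cmod_ge_0 alpha).
assert (Ca : 0 < 1 - Cmod alpha ^ 2) by nra.
assert (Den : forall u, in_disc u ->
  (1 - Cmod alpha) <= Cmod (1 - Cconj alpha * u)).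
{ intros u Hu. red in Hu.
  assert (T := Cmod_triangle (1 - Cconj alpha * u) (Cconj alpha * u)).
  replace (1 - Cconj alpha * u + Cconj alpha * u)%C with (RtoC 1) in T by ring.
  rewrite Cmod_1, Cmod_mult, Cmod_conj in T. generalize (Cmod_ge_0 u); nra. }
assert (Kz : 0 < kap z).
{ specialize (Den z Hz). red in Hz. generalize (Cmod_ge_0 z); intros.
  apply Rdiv_lt_0_compat; [ apply Rmult_lt_0_compat; nra | apply pow_lt; lra ]. }
set (d := kap z * (1 - Cmod alpha) ^ 2 / (1 - Cmod alpha ^ 2)).
assert (Pd : 0 < d).
{ apply Rdiv_lt_0_compat; [ apply Rmult_lt_0_compat; [ easy | apply pow_lt; lra ] | easy ]. }
assert (Far : forall n, d <= 1 - Cmod (Nat.iter n phi z) ^ 2).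
{ intros n. destruct (Orb n) as [H1 H2]. set (u := Nat.iter n phi z) in *.
  specialize (Den u H1). apply Rle_div_l; [ easy | ].
  rewrite <- H2.
  replace ((1 - Cmod u ^ 2) * (1 - Cmod alpha ^ 2))
    with (kap u * Cmod (1 - Cconj alpha * u) ^ 2) by (unfold kap; field; lra).
  apply Rmult_le_compat_l; [ lra | ]. apply pow_incr; lra. }
assert (Pc := aut_c_pos psi). assert (Ha := aut_a_lt1 psi).
set (b := aut_a psi) in *. set (c := 1 - Cmod b ^ 2) in *.
assert (PsiB : forall n, Cmod (psi (Nat.iter n phi z)) ^ 2 <= 1 - c * d / 4).
{ intros n. destruct (Orb n) as [H1 _]. specialize (Far n).
  set (u := Nat.iter n phi z) in *. red in H1.
  assert (Hm := Cmod_lt_mult b u Ha ltac:(lra)).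
  assert (D := aut_defect psi u Hm). fold b c in D.
  assert (P := proj1 (Cmod_gt_0 _) (moebius_den_neq0 b u Hm)).
  assert (T : Cmod (1 - Cconj b * u) <= 2).
  { apply Rle_trans with (1 := Cmod_triangle _ _).
    rewrite Cmod_1, Cmod_opp, Cmod_mult, Cmod_conj. lra. }
  assert (Q : Cmod (1 - Cconj b * u) ^ 2 <= 4).
  { replace 4 with (2 ^ 2) by ring. apply pow_incr; lra. }
  assert (A : c * d / 4 <= c * (1 - Cmod u ^ 2) / Cmod (1 - Cconj b * u) ^ 2).
  { unfold Rdiv. apply Rmult_le_compat; [ nra | lra | nra | ].
    apply Rinv_le_contravar; [ now apply pow_lt | easy ]. }
  lra. }
assert (X0 : 0 <= 1 - c * d / 4) by (apply Rle_trans with (2 := PsiB 0%nat), pow2_ge_0).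
exists (sqrt (1 - c * d / 4)). split.
- split; [ apply sqrt_pos | ]. assert (0 < c * d) by now apply Rmult_lt_0_compat.
  apply Rlt_le_trans with (sqrt 1); [ apply sqrt_lt_1; lra | rewrite sqrt_1; lra ].
- intros n. rewrite <- (sqrt_pow2 (Cmod _)) by apply Cmod_ge_0.
  apply sqrt_le_1; [ apply pow2_ge_0 | exact X0 | apply PsiB ].
Qed.

(** Each application of the operator contributes the value of [psi] at one
    more point of the orbit. *)
Lemma Cmod_iter_MU_le (f : C -> C) (rho : R) (n : nat) : 0 <= rho -> forall z,
  (forall k, Cmod (psi (Nat.iter k phi z)) <= rho) ->
  Cmod (Nat.iter n MU f z) <= rho ^ n * Cmod (Nat.iter n (U_op p phi) f z).
Proof.
intros Hrho. induction n as [|n IH]; intros z Hz.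
{ simpl. lra. }
simpl Nat.iter. rewrite MU_E, U_opE, !Cmod_mult.
specialize (IH (phi z) ltac:(intros k; rewrite <- Nat.iter_succ_r; apply (Hz (S k)))).
specialize (Hz 0%nat). simpl in Hz. simpl pow.
replace (rho * rho ^ n * (Cmod (aut_root phi p z) * Cmod (Nat.iter n (U_op p phi) f (phi z))))
  with (rho * (Cmod (aut_root phi p z) * (rho ^ n * Cmod (Nat.iter n (U_op p phi) f (phi z)))))
  by ring.
apply Rmult_le_compat; [ apply Cmod_ge_0 | | exact Hz | ].
- apply Rmult_le_pos; apply Cmod_ge_0.
- apply Rmult_le_compat_l; [ apply Cmod_ge_0 | exact IH ].
Qed.

Lemma iter_MU_bounds (f : C -> C) (K : R) (n : nat) : holo_disc 1 f ->
  holo_disc 1 (Nat.iter n MU f) /\ holo_disc 1 (Nat.iter n (U_op p phi) f) /\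
  (pmean_bound p (Nat.iter n MU f) K <-> pmean_bound p f K) /\
  (pmean_bound p (Nat.iter n (U_op p phi) f) K <-> pmean_bound p f K).
Proof.
intros Hf. induction n as [|n [IH1 [IH2 [IH3 IH4]]]]; [ easy | ].
simpl. split; [ now apply holo_MU | split; [ now apply holo_U | split ] ].
- rewrite <- IH3. now apply pmean_bound_MU_iff.
- rewrite <- IH4. now apply pmean_bound_U_iff.
Qed.

(** If [g] is the [n]-th image of [f], then [U^n f] has the same means as [g],
    so [U^n f] is bounded at [z] independently of [n], while the factor
    [rho ^ n] tends to 0. *)
Lemma power_range_zero (alpha : C) (g : C -> C) :
  in_disc alpha -> phi alpha = alpha -> in_Hp p g ->
  (forall n, (1 <= n)%nat -> in_power_range p MU n g) -> eq_on_disc g (fun _ => RtoC 0).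
Proof.
intros Hal Efix Hg Hran z Hz.
apply in_Hp_iff in Hg. destruct Hg as [Hg [K HK]].
destruct (orbit_bound alpha z Hal Efix Hz) as [rho [Hrho Horb]].
destruct (point_bound p Hp z Hz) as [B HB].
set (M := rpow (B * K) (/ p)).
assert (Hi : 0 < / p) by (apply Rinv_0_lt_compat; lra).
assert (M0 : 0 <= M) by apply rpow_ge0.
assert (Bound : forall n, (1 <= n)%nat -> Cmod (g z) <= rho ^ n * M).
{ intros n Hn. destruct (Hran n Hn) as [f [Hf Ef]].
  apply in_Hp_iff in Hf. destruct Hf as [Hf _].
  destruct (iter_MU_bounds f K n Hf) as [_ [H2 [H3 H4]]].
  assert (HU : pmean_bound p (Nat.iter n (U_op p phi) f) K).
  { apply H4, H3. exact (pmean_bound_ext _ _ _ Ef HK). }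
  rewrite (Ef z Hz).
  apply Rle_trans with (1 := Cmod_iter_MU_le f rho n (proj1 Hrho) z Horb).
  apply Rmult_le_compat_l; [ apply pow_le; lra | ].
  specialize (HB _ K H2 HU). unfold M.
  rewrite <- (rpow_rpow (Cmod _) p (/ p) (Cmod_ge_0 _)) by (field; lra).
  now apply rpow_mono. }
apply Cmod_eq_0. apply Rle_antisym; [ | apply Cmod_ge_0 ].
apply le_epsilon; intros eps He. rewrite Rplus_0_l.
destruct (pow_lt_1_zero rho ltac:(rewrite Rabs_pos_eq; lra) (eps / (M + 1))) as [N HN].
{ apply Rdiv_lt_0_compat; lra. }
specialize (HN (S N) ltac:(lia)). rewrite Rabs_pos_eq in HN by (apply pow_le; lra).
apply Rlt_div_r in HN; [ | lra ].
specialize (Bound (S N) ltac:(lia)).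
assert (Pr : 0 <= rho ^ S N) by (apply pow_le; lra). nra.
Qed.

Lemma zero_power_range (g : C -> C) (n : nat) :
  eq_on_disc g (fun _ => RtoC 0) -> in_power_range p MU n g.
Proof.
intros Hg. exists (fun _ => RtoC 0). split; [ apply in_Hp_const | ].
intros z Hz. rewrite (Hg z Hz). clear g Hg Hz. revert z.
induction n as [|n IH]; intros z; [ easy | ].
simpl. rewrite MU_E, <- IH. ring.
Qed.

End Composite.
End Operators.

Theorem proposition3 (p : R) (hp1 : 1 <= p) (hp2 : p <> 2)
    (phi psi : disc_aut) (hphi : elliptic phi) :
  Crownover p (fun f => mul_op psi (U_op p phi f)).
Proof.
destruct hphi as [_ [alpha [Hal Efix]]].
change (Crownover p (MU_op p phi psi)). split.
- now apply MU_codim_one_isometry.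
- intros g Hg; split.
  + now apply (power_range_zero p hp1 phi psi alpha).
  + intros H n _. now apply zero_power_range.
Qed.
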